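(* Let $(M,\omega)$ be a symplectic manifold and let $f,g\in C^{\infty}(M)$. Define $\Phi:M\to\mathbb{R}$ by $$\Phi=-\{\{\{f,g\},f\},f\}-\{\{\{f,g\},g\},g\}.$$ Assume that $\{f,g\}$ attains its maximum at a point $x\in M$, and that $x$ is a non-degenerate critical point of $\{f,g\}$. Let $U$ be a neighborhood of $x$ such that $\{f,g\}(y)<\{f,g\}(x)$ for every $y\in\overline{U}\setminus\{x\}$. Then there is a neighborhood $V$ of $x$ with $\overline{V}\subset U$ such that for all sufficiently small $\varepsilon>0$ there exist smooth functions $F,G:M\to\mathbb{R}$ satisfying $$\|F-f\|\leqslant\varepsilon,\qquad \|G-g\|\leqslant\varepsilon,$$ $$\{F,G\}(y)\leqslant\{f,g\}(x)-\tfrac13\,\Phi(x)^{1/3}\varepsilon^{2/3}\qquad\text{for all }y\in U,$$ and $F=f$, $G=g$ on $M\setminus V$.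
   Context: For $H\in C^\infty(M)$ the Hamiltonian vector field $X_H$ is defined by $\omega(X_H,\cdot)=dH$ (the sign convention is immaterial), and $\{f,g\}=df(X_g)$. $\|h\|=\sup_M|h|$ is the uniform norm.
   Formalization: The closure of U is assumed compact; without this the claim fails, e.g. M=U=R^2 with {f,g}=1-|z|^2 exp(-|z|^2), which tends to its maximum at infinity. If {f,g} stays a fixed amount below {f,g}(x) on U away from x, the claim follows by using a smaller U. *)

(* Defs.v *)
From HB Require Import structures.
From mathcomp Require Import all_boot all_order all_algebra.
From mathcomp Require Import all_classical all_reals all_analysis.

Set Implicit Arguments.
Unset Strict Implicit.
Unset Printing Implicit Defensive.

Import Order.TTheory GRing.Theory Num.Theory.
Import numFieldNormedType.Exports.

Local Open Scope classical_set_scope.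
Local Open Scope ring_scope.

(* [A] is meant to be open. In finite dimension, a map is C^(k+1) iff it is
   differentiable and all its directional derivatives are C^k. *)
Fixpoint continuously_diff_on (R : realType) (V W : normedModType R) (k : nat)
    (A : set V) (f : V -> W) : Prop :=
  if k is k'.+1 then
    (forall u, A u -> differentiable f u) /\
    (forall v, continuously_diff_on k' A (fun u => 'd f u v))
  else forall u, A u -> {for u, continuous f}.

Definition smooth_on (R : realType) (V W : normedModType R) (A : set V)
    (f : V -> W) : Prop :=
  forall k, continuously_diff_on k A f.

(* [coord] and [param] are total functions; they are only meaningful on [dom]
   and [coord @` dom], where they are mutually inverse homeomorphisms. *)
Record chart (R : realType) (n : nat) (M : topologicalType) := Chart {
  dom : set M;
  coord : M -> 'rV[R]_n;
  param : 'rV[R]_n -> M;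
  dom_open : open dom;
  coord_open : open (coord @` dom);
  coordK : forall y, dom y -> param (coord y) = y;
  coord_continuous : forall y, dom y -> {for y, continuous coord};
  param_continuous :
    forall u, (coord @` dom) u -> {for u, continuous param} }.

(* A manifold without boundary, of pure dimension [n]. The atlas need not be
   maximal; [chart_at y] is a preferred chart around [y], through which the
   tangent space at [y] is identified with 'rV[R]_n. *)
Record smoothManifold (R : realType) (n : nat) := SmoothManifold {
  carrier :> topologicalType;
  carrier_hausdorff : hausdorff_space carrier;
  carrier_second_countable : @second_countable carrier;
  atlas : set (chart R n carrier);
  chart_at : carrier -> chart R n carrier;
  chart_at_atlas : forall y, atlas (chart_at y);
  chart_at_dom : forall y, dom (chart_at y) y;
  atlas_compatible : forall c c', atlas c -> atlas c' ->
    smooth_on (coord c @` (dom c `&` dom c')) (coord c' \o param c) }.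

Definition smooth (R : realType) (n : nat) (M : smoothManifold R n)
    (h : M -> R) : Prop :=
  forall c, atlas c -> smooth_on (coord c @` dom c) (h \o param c).

(* A 2-form is given by its coefficient matrices in the charts of the atlas:
   at the point of coordinates [u], omega (v, w) = v *m coef c u *m w^T. *)
Record symplecticForm (R : realType) (n : nat) (M : smoothManifold R n) :=
  SymplecticForm {
  coef : chart R n M -> 'rV[R]_n -> 'M[R]_n;
  coef_smooth : forall c, atlas c -> forall i j,
    smooth_on (coord c @` dom c) (fun u => coef c u i j);
  coef_compatible : forall c c' y, atlas c -> atlas c' -> dom c y -> dom c' y ->
    forall v w : 'rV[R]_n,
      let J := 'd (coord c' \o param c) (coord c y) in
      v *m coef c (coord c y) *m w^T =
      J v *m coef c' (coord c' y) *m (J w)^T;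
  coef_skew : forall c y, atlas c -> dom c y ->
    (coef c (coord c y))^T = - coef c (coord c y);
  coef_nondegenerate : forall c y, atlas c -> dom c y ->
    coef c (coord c y) \in unitmx;
  coef_closed : forall c y, atlas c -> dom c y -> forall i j k,
    let d l a b :=
      'd (fun u => coef c u a b) (coord c y) (delta_mx 0 l : 'rV[R]_n) in
    d i j k + d j k i + d k i j = 0 }.

Lemma diff_near_comp (R : realType) (V W Z : normedModType R) (k : V -> Z)
    (t : V -> W) (k' : W -> Z) (a : V) (b : W) (w : V) :
  t a = b -> differentiable k a -> differentiable k' b -> differentiable t a ->
  (\forall u \near a, k u = k' (t u)) -> 'd k a w = 'd k' b ('d t a w).
Proof.
move=> <- dk dk' dt kk'.
have -> : 'd k' (t a) ('d t a w) = ('d k' (t a) \o 'd t a) w by [].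
rewrite -diff_comp// -!deriveE//; last exact: differentiable_comp.
exact: near_eq_derive.
Qed.

Section Poisson.
Context (R : realType) (n : nat) (M : smoothManifold R n).
Variable omega : symplecticForm M.

Definition form_in (c : chart R n M) (y : M) (v w : 'rV[R]_n) : R :=
  (v *m coef omega c (coord c y) *m w^T) 0 0.

Definition differential_in (c : chart R n M) (h : M -> R) (y : M)
    (w : 'rV[R]_n) : R :=
  'd (h \o param c) (coord c y) w.

(* The coordinates of X_h at [y], where omega (X_h, .) = dh. *)
Definition hamiltonian_vf_in (c : chart R n M) (h : M -> R) (y : M) :
    'rV[R]_n :=
  xget 0 [set X | forall w, form_in c y X w = differential_in c h y w].

(* {f, g} = df (X_g), computed in the preferred chart; any other chart of the
   atlas gives the same value for smooth [f] and [g] ([poisson_chart]). *)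
Definition poisson (f g : M -> R) (y : M) : R :=
  differential_in (chart_at y) f y (hamiltonian_vf_in (chart_at y) g y).

Lemma hamiltonian_vf_in_unique c h y X : atlas c -> dom c y ->
  (forall w, form_in c y X w = differential_in c h y w) ->
  hamiltonian_vf_in c h y = X.
Proof.
move=> cA cy XE; rewrite /hamiltonian_vf_in.
case: xgetP => [Y _ YE|/(_ X)/(_ XE)//].
apply: (can_inj (mulmxK (coef_nondegenerate omega cA cy))).
apply/rowP => j; have := YE (delta_mx 0 j); rewrite -XE /form_in.
by rewrite !trmx_delta -!colE !mxE.
Qed.

Lemma hamiltonian_vf_inP c h y : atlas c -> dom c y ->
  forall w, form_in c y (hamiltonian_vf_in c h y) w = differential_in c h y w.
Proof.
move=> cA cy.
suff [X XE] : exists X, forall w, form_in c y X w = differential_in c h y w.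
  by rewrite (hamiltonian_vf_in_unique cA cy XE).
exists ((\row_j differential_in c h y (delta_mx 0 j))
        *m invmx (coef omega c (coord c y))) => w.
rewrite /form_in mulmxKV ?coef_nondegenerate// mxE.
rewrite {2}(row_sum_delta w) /differential_in linear_sum.
by apply: eq_bigr => j _; rewrite !mxE linearZ /= mulrC.
Qed.

Lemma differential_in_chart c c' h y w :
  atlas c -> atlas c' -> dom c y -> dom c' y -> smooth h ->
  differential_in c' h y w =
  differential_in c h y ('d (coord c \o param c') (coord c' y) w).
Proof.
move=> cA c'A cy c'y hs; apply: diff_near_comp.
- by rewrite /= coordK.
- by apply: (hs c' c'A 1%N).1; exists y.
- by apply: (hs c cA 1%N).1; exists y.
- by apply: (atlas_compatible c'A cA 1%N).1; exists y.
have : \forall u \near coord c' y, dom c (param c' u).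
  apply: (param_continuous (c := c')); first by exists y.
  by rewrite coordK//; apply: open_nbhs_nbhs; split=> //; exact: dom_open.
by apply: filterS => u cu /=; rewrite coordK.
Qed.

Lemma poisson_chart c f g y : atlas c -> dom c y -> smooth f -> smooth g ->
  poisson f g y = differential_in c f y (hamiltonian_vf_in c g y).
Proof.
rewrite /poisson; move: (chart_at_atlas y) (chart_at_dom y).
move: (chart_at y) => c' c'A c'y cA cy fs gs.
set J := 'd (coord c \o param c') (coord c' y).
pose Jm := lin1_mx J.
have JE v : J v = v *m Jm by rewrite mul_rV_lin1.
have dE h w : smooth h ->
    differential_in c' h y w = differential_in c h y (J w).
  exact: differential_in_chart.
have OE : coef omega c' (coord c' y) =
    Jm *m coef omega c (coord c y) *m Jm^T.
  apply/matrixP => i j.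
  have := coef_compatible omega c'A cA c'y cy (delta_mx 0 i) (delta_mx 0 j).
  rewrite /= -/J !JE trmx_mul !mulmxA => /matrixP/(_ 0 0).
  rewrite -!(mulmxA (delta_mx 0 i)) mulmxA trmx_delta.
  by rewrite -!rowE -!colE !mxE.
have Ju : Jm \in unitmx.
  have := coef_nondegenerate omega c'A c'y.
  by rewrite OE -mulmxA unitmx_mul => /andP[].
rewrite dE//; congr differential_in; apply/esym.
apply: hamiltonian_vf_in_unique => // w.
have -> : w = J (w *m invmx Jm) by rewrite JE mulmxKV.
rewrite -dE// -(hamiltonian_vf_inP g c'A c'y) /form_in.
by rewrite (coef_compatible omega c'A cA c'y cy).
Qed.

End Poisson.

Section Critical.
Context (R : realType) (n : nat) (M : smoothManifold R n).

Definition hessian (h : 'rV[R]_n -> R) (u : 'rV[R]_n) : 'M[R]_n :=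
  \matrix_(i, j) 'd (fun v => 'd h v (delta_mx 0 j : 'rV[R]_n)) u (delta_mx 0 i).

Definition nondegenerate_critical (h : M -> R) (y : M) : Prop :=
  (forall w, differential_in (chart_at y) h y w = 0) /\
  hessian (h \o param (chart_at y)) (coord (chart_at y) y) \in unitmx.

Definition uniform_norm (h : M -> R) : \bar R :=
  ereal_sup [set `|h y|%:E | y in [set: M]].

End Critical.

(* Main.v *)
Require Import Defs.
From HB Require Import structures.
From mathcomp Require Import all_boot all_order all_algebra.
From mathcomp Require Import all_classical all_reals all_analysis.
From mathcomp Require Import ring lra.

Set Implicit Arguments.
Unset Strict Implicit.
Unset Printing Implicit Defensive.

Import Order.TTheory GRing.Theory Num.Theory.
Import numFieldNormedType.Exports.

Local Open Scope classical_set_scope.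
Local Open Scope ring_scope.

(** The bracket is lowered by perturbing one of the two functions only. For
fixed [g], the map [F |-> {F, g}] is linear: [{f + u, g} = {f, g} + du(X_g)], so
there is no quadratic error term to control. Write [h = {f, g}], and let [Q] be
minus half the Hessian form of [h] at [x]. Since [x] is a nondegenerate maximum,
[Q] is positive definite, and [h = h(x) - Q + o(Q)] near [x]. At the critical
point, [- {{h, g}, g}(x) = 2 Q(xi)] with [xi = X_g(x)], so that
[Phi(x) = 2 Q(X_f) + 2 Q(X_g)]. Replacing [(f, g)] by [(g, - f)], which
leaves the bracket unchanged, one may assume [Phi(x) <= 4 q] where
[q = Q(xi)]. If [q = 0] then [Phi(x) = 0], and [(f, g)] itself will do.

Let [D] be defined by [D^3 = q eps^2]. At distance of order [eps^(1/3)] from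
[x], [Q] is of order [D], and a function of size [eps] may have a derivative of
order [D] along [xi]. What is needed is a function [u] with [|u| <= eps],
supported where [Q <= 6 D], and such that [du(xi) <= Q - c D] with [c] large
enough: where [Q] is small [u] must decrease along [xi], and it may return to
zero only where [Q] itself pays for it. With [B] the polar form of [Q], the
choice is [u = - (D / q) B(z, xi) b(Q(z) / (6 D))] where
[b(s) = exp (- s / (1 - s))] for [s < 1] and [b(s) = 0] otherwise
([slope_bump]). The Cauchy-Schwarz inequality for [B] reduces both requirements
to inequalities in the single variable [s = Q(z) / (6 D)]: [6 s b^2 <= 1] for
the size ([bump_le]), and [27/5 s + 9/10 b - 11/5 s |b'| >= 8/15] for the
decrease ([bump_drop]). The latter includes a margin of ten percent, which
absorbs the remainder of the expansion of [h] and the variation of [X_g] near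
[x] ([adapted_ball]). Hence [{f + u, g} <= h(x) - 8/15 D] near [x], and
[8/15 D >= 1/3 Phi(x)^(1/3) eps^(2/3)] because [4 <= (8/5)^3]. Away from [x]
but in [U], [h] stays below [h(x)] by a fixed amount, by compactness
([max_gap]).

The rest is the calculus that this argument rests on: stability of smooth maps
under the operations used to build the bracket and [u], the symmetry and the
sign of the Hessian at a maximum ([hessian_sym], [hessian_max]), both
consequences of the second-order expansion [taylor2_critical], and the
extension by zero of functions supported in a chart ([smooth_extension]). *)

(** * Calculus of smooth maps *)

Section SmoothCalculus.
Context (R : realType) (V : normedModType R).
Implicit Types (A B : set V) (k : nat).

Lemma continuously_diff_onS (W : normedModType R) k A B (f : V -> W) :
  B `<=` A -> continuously_diff_on k A f -> continuously_diff_on k B f.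
Proof.
elim: k f => [|k IH] f BA /=; first by move=> fA u /BA; exact: fA.
by move=> [df Df]; split=> [u /BA/df //|v]; exact: IH.
Qed.

Lemma continuously_diff_onU (W : normedModType R) k A B (f : V -> W) :
  continuously_diff_on k A f -> continuously_diff_on k B f ->
  continuously_diff_on k (A `|` B) f.
Proof.
elim: k f => [|k IH] f /=; first by move=> fA fB u [/fA|/fB].
by move=> [dA DA] [dB DB]; split=> [u [/dA|/dB] //|v]; exact: IH.
Qed.

Lemma continuously_diff_on_le (W : normedModType R) k A (f : V -> W) :
  continuously_diff_on k.+1 A f -> continuously_diff_on k A f.
Proof.
elim: k f => [|k IH] f /=.
  by move=> [df _] u /df; exact: differentiable_continuous.
by move=> [df Df]; split=> // v; apply: IH; exact: Df.
Qed.

(** This lemma and the next convert between [differentiable], defined by a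
little-o, and its epsilon form. *)
Lemma diff_le (W : normedModType R) (f : V -> W) (u : V) (e : R) :
  differentiable f u -> 0 < e ->
  \forall h \near (0 : V), `|f (h + u) - f u - 'd f u h| <= e * `|h|.
Proof.
move=> /diff_locally /eqaddoP fE e0; apply: filterS (fE e e0) => h.
by rewrite !fctE /= opprD addrA.
Qed.

Lemma diff_intro (W : normedModType R) (f : V -> W) (df : {linear V -> W})
    (u : V) :
  continuous df ->
  (forall e, 0 < e ->
    \forall h \near (0 : V), `|f (h + u) - f u - df h| <= e * `|h|) ->
  differentiable f u /\ ('d f u = df :> (V -> W)).
Proof.
move=> cdf fE.
have fo : f \o shift u = cst (f u) + df +o_ (0 : V) id.
  apply/eqaddoP => e e0; apply: filterS (fE e e0) => h.
  by rewrite !fctE /= opprD addrA.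
have dE : 'd f u = df :> (V -> W) by exact: diff_unique.
by split=> //; apply/diff_locallyP; rewrite dE.
Qed.

Lemma near_eq_diff (W : normedModType R) (f g : V -> W) (u : V) :
  differentiable f u -> (\forall v \near u, f v = g v) ->
  differentiable g u /\ ('d g u = 'd f u :> (V -> W)).
Proof.
move=> df fg; apply: diff_intro; first exact: diff_continuous.
move=> e e0; have fgu : f u = g u := nbhs_singleton fg.
have fg0 : \forall h \near (0 : V), f (h + u) = g (h + u).
  by move: fg; rewrite (near_shift 0); apply: filterS => h /=; rewrite subr0.
near=> h; rewrite -fgu -(near fg0 h)//.
by near: h; exact: diff_le.
Unshelve. all: by end_near. Qed.

Lemma eq_continuously_diff_on (W : normedModType R) k A (f g : V -> W) :
  open A -> (forall u, A u -> f u = g u) ->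
  continuously_diff_on k A f -> continuously_diff_on k A g.
Proof.
move=> oA; elim: k f g => [|k IH] f g fg /=.
  move=> cf u Au; suff : g @ u --> f u by rewrite fg.
  apply: cvg_trans (cf u Au); apply: near_eq_cvg.
  by apply: filterS (open_nbhs_nbhs (conj oA Au)) => v /fg.
move=> [df Df].
have fgn u : A u -> \forall v \near u, f v = g v.
  by move=> Au; apply: filterS (open_nbhs_nbhs (conj oA Au)) => v /fg.
split=> [u Au|v].
  by have [] := near_eq_diff (df u Au) (fgn u Au).
apply: IH (Df v) => u Au.
by have [_ ->] := near_eq_diff (df u Au) (fgn u Au).
Qed.

Lemma smooth_onS (W : normedModType R) A B (f : V -> W) :
  B `<=` A -> smooth_on A f -> smooth_on B f.
Proof. by move=> BA fA k; exact: continuously_diff_onS (fA k). Qed.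

Lemma smooth_onU (W : normedModType R) A B (f : V -> W) :
  smooth_on A f -> smooth_on B f -> smooth_on (A `|` B) f.
Proof. by move=> fA fB k; exact: continuously_diff_onU. Qed.

Lemma eq_smooth_on (W : normedModType R) A (f g : V -> W) :
  open A -> (forall u, A u -> f u = g u) -> smooth_on A f -> smooth_on A g.
Proof. by move=> oA fg fA k; exact: eq_continuously_diff_on (fA k). Qed.

Lemma smooth_on_differentiable (W : normedModType R) A (f : V -> W) u :
  smooth_on A f -> A u -> differentiable f u.
Proof. by move=> /(_ 1%N)[df _] /df. Qed.

Lemma smooth_on_continuous (W : normedModType R) A (f : V -> W) u :
  smooth_on A f -> A u -> {for u, continuous f}.
Proof. by move=> /(_ 0%N); exact. Qed.

Lemma smooth_on_diff (W : normedModType R) A (f : V -> W) v :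
  smooth_on A f -> smooth_on A (fun u => 'd f u v).
Proof. by move=> fA k; exact: (fA k.+1).2. Qed.

Lemma smooth_on_cst (W : normedModType R) A (a : W) :
  smooth_on A (fun=> a : W).
Proof.
move=> k; elim: k a => [|k IH] a /=; first by move=> u _; exact: cst_continuous.
split=> [u _|v]; first exact: differentiable_cst.
have -> : (fun u => 'd (fun=> a) u v) = (fun=> 0 : W).
  by apply/funext => u; rewrite diff_cst.
exact: IH.
Qed.

Lemma smooth_on_linear (W : normedModType R) A (f : {linear V -> W}) :
  continuous f -> smooth_on A f.
Proof.
move=> cf [|k] /=; first by move=> u _; exact: cf.
split=> [u _|v]; first exact: linear_differentiable.
have -> : (fun u => 'd f u v) = (fun=> f v).
  by apply/funext => u; rewrite diff_lin.
exact: smooth_on_cst.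
Qed.

(** The closure properties are proved at each finite order, because the
derivative of a product or of an inverse involves the functions themselves,
about which only the order at hand is known. *)
Lemma continuously_diff_onD (W : normedModType R) k A (f g : V -> W) :
  open A -> continuously_diff_on k A f -> continuously_diff_on k A g ->
  continuously_diff_on k A (fun u => f u + g u).
Proof.
move=> oA; elim: k f g => [|k IH] f g /=.
  by move=> cf cg u Au; apply: (@continuousD _ _ _ f g); [exact: cf|exact: cg].
move=> [df Df] [dg Dg]; split=> [u Au|v].
  by apply: (@differentiableD _ _ _ f g); [exact: df|exact: dg].
apply: (eq_continuously_diff_on oA) (IH _ _ (Df v) (Dg v)) => u Au.
exact: esym (congr1 (@^~ v) (@diffD _ _ _ f g _ (df u Au) (dg u Au))).
Qed.

Lemma continuously_diff_onM k A (f g : V -> R) :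
  open A -> continuously_diff_on k A f -> continuously_diff_on k A g ->
  continuously_diff_on k A (fun u => f u * g u).
Proof.
move=> oA; elim: k f g => [|k IH] f g.
  by move=> cf cg u Au; apply: (@continuousM _ _ f g); [exact: cf|exact: cg].
move=> f1 g1; have [df Df] := f1; have [dg Dg] := g1.
have f0 := continuously_diff_on_le f1; have g0 := continuously_diff_on_le g1.
split=> [u Au|v].
  by apply: (@differentiableM _ _ f g); [exact: df|exact: dg].
apply: (eq_continuously_diff_on oA)
  (continuously_diff_onD oA (IH _ _ f0 (Dg v)) (IH _ _ g0 (Df v))) => u Au.
exact: esym (congr1 (@^~ v) (@diffM _ _ f g _ (df u Au) (dg u Au))).
Qed.

Lemma continuously_diff_onV k A (f : V -> R) :
  open A -> (forall u, A u -> f u != 0) ->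
  continuously_diff_on k A f -> continuously_diff_on k A (fun u => (f u)^-1).
Proof.
move=> oA f0; elim: k => [|k IH].
  by move=> cf u Au; apply: (@continuousV _ _ f); [exact: f0|exact: cf].
move=> f1; have [df Df] := f1.
have Vk := IH (continuously_diff_on_le f1).
have N1k := smooth_on_cst A (-1 : R) k.
split=> [u Au|v].
  by apply: (@differentiableV _ _ f); [exact: df|exact: f0].
apply: (eq_continuously_diff_on oA) (continuously_diff_onM oA
  (continuously_diff_onM oA N1k (Df v)) (continuously_diff_onM oA Vk Vk)) => u Au.
apply/esym; apply: etrans (congr1 (@^~ v) (@diffV _ _ f _ (df u Au) (f0 u Au))) _.
by rewrite /= -invfM -expr2 mulN1r mulNr mulrC -mulNr.
Qed.

Lemma smooth_onD (W : normedModType R) A (f g : V -> W) :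
  open A -> smooth_on A f -> smooth_on A g -> smooth_on A (fun u => f u + g u).
Proof. by move=> oA fA gA k; exact: continuously_diff_onD. Qed.

Lemma smooth_onM A (f g : V -> R) :
  open A -> smooth_on A f -> smooth_on A g -> smooth_on A (fun u => f u * g u).
Proof. by move=> oA fA gA k; exact: continuously_diff_onM. Qed.

Lemma smooth_onV A (f : V -> R) : open A -> (forall u, A u -> f u != 0) ->
  smooth_on A f -> smooth_on A (fun u => (f u)^-1).
Proof. by move=> oA f0 fA k; exact: continuously_diff_onV. Qed.

Lemma continuously_diff_on_sum (W : normedModType R) k A (I : Type) (r : seq I)
    (f : I -> V -> W) :
  open A -> (forall i, continuously_diff_on k A (f i)) ->
  continuously_diff_on k A (fun u => \sum_(i <- r) f i u).
Proof.
move=> oA fA; elim: r => [|i r IH].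
  by apply: (eq_continuously_diff_on oA) (smooth_on_cst A (0 : W) k) => u _;
     rewrite big_nil.
by apply: (eq_continuously_diff_on oA) (continuously_diff_onD oA (fA i) IH) => u _;
   rewrite big_cons.
Qed.

Lemma smooth_on_sum (W : normedModType R) A (I : Type) (r : seq I)
    (f : I -> V -> W) :
  open A -> (forall i, smooth_on A (f i)) ->
  smooth_on A (fun u => \sum_(i <- r) f i u).
Proof. by move=> oA fA k; apply: continuously_diff_on_sum => // i; exact: fA. Qed.

Lemma smooth_on_prod A (I : Type) (r : seq I) (f : I -> V -> R) :
  open A -> (forall i, smooth_on A (f i)) ->
  smooth_on A (fun u => \prod_(i <- r) f i u).
Proof.
move=> oA fA; elim: r => [|i r IH].
  by apply: (eq_smooth_on oA) (smooth_on_cst A (1 : R)) => u _; rewrite big_nil.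
by apply: (eq_smooth_on oA) (smooth_onM oA (fA i) IH) => u _; rewrite big_cons.
Qed.

Lemma smooth_on_det A m (f : V -> 'M[R]_m) : open A ->
  (forall i j, smooth_on A (fun u => f u i j)) ->
  smooth_on A (fun u => \det (f u)).
Proof.
move=> oA fA; apply: smooth_on_sum => // s; apply: smooth_onM => //.
  exact: smooth_on_cst.
by apply: smooth_on_prod => // i; exact: fA.
Qed.

(** By Cramer's rule, the entries of the inverse are cofactors divided by the
determinant. *)
Lemma smooth_on_invmx A m (f : V -> 'M[R]_m) : open A ->
  (forall u, A u -> f u \in unitmx) ->
  (forall i j, smooth_on A (fun u => f u i j)) ->
  forall i j, smooth_on A (fun u => invmx (f u) i j).
Proof.
move=> oA fU fA i j.
apply: (@eq_smooth_on _ A (fun u => (\det (f u))^-1 * (\adj (f u)) i j)) => //.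
  by move=> u Au; rewrite /invmx fU// !mxE.
apply: smooth_onM => //.
  apply: smooth_onV => //; last exact: smooth_on_det.
  by move=> u /fU; rewrite unitmxE unitfE.
apply: (@eq_smooth_on _ A (fun u =>
    (-1) ^+ (j + i) * \det (row' j (col' i (f u))))) => //.
  by move=> u _; rewrite mxE.
apply: smooth_onM => //; first exact: smooth_on_cst.
apply: smooth_on_det => // a b.
by apply: (eq_smooth_on oA _ (fA (lift j a) (lift i b))) => u _; rewrite !mxE.
Qed.

End SmoothCalculus.

Section SmoothComposition.
Context (R : realType).

Lemma linear_diff (V W : normedModType R) (f : V -> W) u :
  linear f -> continuous f ->
  differentiable f u /\ ('d f u = f :> (V -> W)).
Proof.
move=> lf cf; pose fL : {linear V -> W} := HB.pack f
  (GRing.isLinear.Build _ _ _ _ f lf).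
split; first exact: (@linear_differentiable _ _ _ fL).
exact: (@diff_lin _ _ _ fL).
Qed.

Lemma diff_coord m (j : 'I_m) (u v : 'rV[R]_m) :
  'd (fun w : 'rV[R]_m => w 0 j) u v = v 0 j.
Proof.
have [||_ ->//] := @linear_diff _ _ (fun w : 'rV[R]_m => w 0 j : R) u.
  by move=> a v1 v2; rewrite !mxE.
exact: coord_continuous.
Qed.


Context (V : normedModType R).

Lemma continuously_diff_on_coord k (A : set V) m (t : V -> 'rV[R]_m) j :
  open A -> continuously_diff_on k A t ->
  continuously_diff_on k A (fun u => t u 0 j).
Proof.
move=> oA; elim: k t => [|k IH] t /=.
  move=> ct u Au; apply: (@continuous_comp _ _ _ t (fun w : 'rV[R]_m => w 0 j)).
    exact: ct.
  exact: coord_continuous.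
move=> [dt Dt]; split=> [u Au|v].
  apply: (@differentiable_comp _ _ _ _ t (fun w : 'rV[R]_m => w 0 j)).
    exact: dt.
  exact: differentiable_coord.
apply: (eq_continuously_diff_on oA) (IH _ (Dt v)) => u Au.
apply/esym; apply: etrans (congr1 (@^~ v) (@diff_comp _ _ _ _ t
  (fun w : 'rV[R]_m => w 0 j) u (dt u Au) (differentiable_coord _ _ _))) _.
exact: diff_coord.
Qed.

(** Expanding the differential of [t] in the canonical basis writes the
derivative of the composition as a finite sum of products of compositions of
the same kind, of order one less. *)
Lemma continuously_diff_on_comp k (A : set V) m (B : set 'rV[R]_m)
    (t : V -> 'rV[R]_m) (f : 'rV[R]_m -> R) :
  open A -> (forall u, A u -> B (t u)) ->
  continuously_diff_on k A t -> continuously_diff_on k B f ->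
  continuously_diff_on k A (fun u => f (t u)).
Proof.
move=> oA AB; elim: k f => [|k IH] f.
  move=> ct cf u Au; apply: (@continuous_comp _ _ _ t f); first exact: ct.
  exact/cf/AB.
move=> t1 f1; have [dt Dt] := t1; have [df Df] := f1.
split=> [u Au|v].
  by apply: (@differentiable_comp _ _ _ _ t f); [exact: dt|exact/df/AB].
apply: (@eq_continuously_diff_on _ _ _ k A
  (fun u => \sum_(j < m) 'd t u v 0 j * 'd f (t u) (delta_mx 0 j))) => //.
  move=> u Au; apply/esym; apply: etrans
    (congr1 (@^~ v) (@diff_comp _ _ _ _ t f u (dt u Au) (df _ (AB _ Au)))) _.
  rewrite /= {1}(row_sum_delta ('d t u v)) linear_sum.
  by apply: eq_bigr => j _; rewrite linearZ.
apply: continuously_diff_on_sum => // j; apply: continuously_diff_onM => //.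
  exact: (continuously_diff_on_coord (t := fun u => 'd t u v) j oA (Dt v)).
exact: (IH _ (continuously_diff_on_le t1) (Df _)).
Qed.

Lemma smooth_on_comp (A : set V) m (B : set 'rV[R]_m)
    (t : V -> 'rV[R]_m) (f : 'rV[R]_m -> R) :
  open A -> (forall u, A u -> B (t u)) ->
  smooth_on A t -> smooth_on B f -> smooth_on A (fun u => f (t u)).
Proof. by move=> oA AB tA fB k; exact: continuously_diff_on_comp (fB k). Qed.

End SmoothComposition.

(** * A smooth function with compact support, with explicit bounds *)

Section FlatFunction.
Context (R : realType).

(** All exponents [m] are considered together because the derivatives of
these functions are combinations of functions of the same family
([flat_is_derive]); smoothness then follows by induction on the order. *)
Definition flat m (x : R) : R := if 0 < x then x ^- m * expR (- x^-1) else 0.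

Lemma flat_ge0 m x : 0 <= flat m x.
Proof.
rewrite /flat; case: ifPn => // x0.
by rewrite mulr_ge0 ?expR_ge0// invr_ge0 exprn_ge0// ltW.
Qed.

(** The exponential beats every power; the exponent 2 is what makes the
derivative at the origin vanish. *)
Lemma flat_le m (x : R) : flat m x <= m.+2`!%:R * x ^+ 2.
Proof.
rewrite /flat; case: ifPn => [x0|_]; last by rewrite mulr_ge0 ?sqr_ge0.
have f0 : 0 < m.+2`!%:R :> R by rewrite ltr0n fact_gt0.
have := @expR_ge1Dxn R x^-1 m.+1; rewrite invr_ge0 (ltW x0) => /(_ isT) e1.
have e2 : x ^- m.+2 / m.+2`!%:R <= expR x^-1.
  by apply: le_trans e1; rewrite exprVn lerDr ler01.
rewrite expRN ler_pdivrMr ?expR_gt0//.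
apply: (@le_trans _ _ (m.+2`!%:R * x ^+ 2 * (x ^- m.+2 / m.+2`!%:R))).
  rewrite le_eqVlt; apply/orP; left; apply/eqP.
  move: f0; set c := (_`!%:R : R) => c0; rewrite -[m.+2]addn2 exprD; field.
  by rewrite !(gt_eqF x0) (gt_eqF c0) expf_neq0 ?(gt_eqF x0).
by rewrite ler_wpM2l// mulr_ge0 ?sqr_ge0// ltW.
Qed.

Lemma is_derive1_comp (f g : R -> R) x a b :
  is_derive (f x) 1 g b -> is_derive x 1 f a -> is_derive x 1 (g \o f) (b * a).
Proof.
move=> [dg <-] [df <-]; apply: DeriveDef.
  apply/derivable1_diffP/differentiable_comp; exact/derivable1_diffP.
by rewrite -!derive1E derive1_comp.
Qed.

Lemma flat_is_derive m (x : R) :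
  is_derive x 1 (flat m) (flat m.+2 x - m%:R * flat m.+1 x).
Proof.
have [x0|x0|->] := ltgtP x 0.
- have -> : flat m.+2 x - m%:R * flat m.+1 x = 0.
    by rewrite /flat (lt_gtF x0) mulr0 subrr.
  apply: near_eq_is_derive (is_derive_cst _ _ _).
  near=> y; rewrite /flat ifF//; apply/negbTE; rewrite -leNgt.
  by near: y; apply: filterS (lt_nbhsl x0) => y /ltW.
- apply: (@near_eq_is_derive R R R (fun x => x ^- m * expR (- x^-1)) (flat m) x 1).
    near=> y; rewrite /flat ifT//; near: y; exact: lt_nbhsr.
  have xn0 : x != 0 by rewrite gt_eqF.
  have dV : is_derive x 1 (fun y : R => y^-1) (- x ^- 2).
    apply: DeriveDef; first by apply: derivableV => //; exact: derivable_id.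
    by rewrite deriveV// derive_id /GRing.scale/= mulr1.
  have d1 : is_derive x 1 (fun y : R => - y^-1) (x ^- 2).
    by apply: is_derive_eq (is_deriveN dV) _; rewrite opprK.
  have d2 : is_derive x 1 (fun y : R => expR (- y^-1)) (expR (- x^-1) * x ^- 2).
    exact: is_derive1_comp (is_derive_expR _) d1.
  have d3 : is_derive x 1 (fun y : R => y ^- m) (- m%:R * x ^- m.+1).
    have -> : (fun y : R => y ^- m) = (fun y : R => y^-1) ^+ m.
      by apply/funext => y; rewrite exprfctE exprVn.
    apply: is_derive_eq (is_deriveX _ dV) _; rewrite -!exprVn /GRing.scale/=.
    case: m => [|m] /=; first by rewrite !mul0r oppr0 mul0r.
    by rewrite (exprD _ 2 m) mulrN mulNr -mulrA (mulrC (_ ^+ m)).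
  apply: is_derive_eq (is_deriveM d3 d2) _.
  rewrite /flat x0 /GRing.scale/= -!exprVn; move: (expR _) => E.
  by rewrite (exprD _ 2 m) (exprS _ m); ring.
- have [|e e0|d0 dE] //:= @diff_intro _ _ _ (flat m) \0 0.
  + exact: cst_continuous.
  + have f0 : 0 < m.+2`!%:R :> R by rewrite ltr0n fact_gt0.
    have d0 : 0 < e / m.+2`!%:R by rewrite divr_gt0.
    apply: filterS (@nbhs0_le _ R _ d0) => h hd.
    rewrite addr0 /flat ltxx !subr0 -/(flat m h) ger0_norm ?flat_ge0//.
    apply: le_trans (flat_le _ _) _; rewrite -real_normK ?num_real// expr2 mulrA.
    by rewrite ler_wpM2r// mulrC -ler_pdivlMr.
  apply: DeriveDef; first exact: diff_derivable.
  by rewrite deriveE// dE /flat ltxx mulr0 subrr.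
Unshelve. all: by end_near. Qed.
Lemma diff_flat m (V : normedModType R) (f : V -> R) u v :
  differentiable f u ->
  differentiable (fun w => flat m (f w)) u /\
  'd (fun w => flat m (f w)) u v =
    (flat m.+2 (f u) - m%:R * flat m.+1 (f u)) * 'd f u v.
Proof.
move=> df; have [d1 dE] := flat_is_derive m (f u).
have dflat : differentiable (flat m) (f u) by exact/derivable1_diffP.
split; first exact: (@differentiable_comp _ _ _ _ f (flat m)).
apply: etrans (congr1 (@^~ v) (@diff_comp _ _ _ _ f (flat m) u df dflat)) _.
by rewrite /= diff1E//= derive1E dE /GRing.scale/= mulrC.
Qed.

Lemma smooth_on_flat m (V : normedModType R) (A : set V) (f : V -> R) :
  open A -> smooth_on A f -> smooth_on A (fun u => flat m (f u)).
Proof.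
move=> oA fA k; elim: k m => [|k IH] m.
  move=> u Au; apply: differentiable_continuous.
  by have [] := diff_flat m 0 (smooth_on_differentiable fA Au).
have df u : A u -> differentiable f u := smooth_on_differentiable fA.
split=> [u /df /(diff_flat m 0)[]//|v].
apply: (@eq_continuously_diff_on _ _ _ k A (fun u =>
  (flat m.+2 (f u) + - m%:R * flat m.+1 (f u)) * 'd f u v)) => //.
  by move=> u /df /(diff_flat m v)[_ ->]; rewrite mulNr.
apply: continuously_diff_onM => //; last exact: smooth_on_diff.
apply: continuously_diff_onD => //.
by apply: continuously_diff_onM => //; exact: smooth_on_cst.
Qed.

(** The profile of the perturbation is [b(s) = expR 1 * flat 0 (1 - s)], whose
derivative is [- expR 1 * flat 2 (1 - s)]. The substitution [s = r / (1 + r)]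
turns [b] into [exp (- r)], and the inequalities [bump_le] and [bump_drop] into
comparisons between an exponential and polynomials. *)
Lemma bumpE (s : R) : s < 1 -> let r := (1 - s)^-1 - 1 in
  [/\ 0 < 1 + r, s = r / (1 + r), expR 1 * flat 0 (1 - s) = expR (- r) &
      expR 1 * flat 2 (1 - s) = (1 + r) ^+ 2 * expR (- r)].
Proof.
move=> s1 r; have s0 : 0 < 1 - s by rewrite subr_gt0.
have rE : 1 + r = (1 - s)^-1 by rewrite /r addrC subrK.
split.
- by rewrite rE invr_gt0.
- rewrite rE /r invrK; field; exact: lt0r_neq0.
- by rewrite /flat s0 expr0 invr1 mul1r -expRD; congr expR; rewrite /r; ring.
- rewrite /flat s0 mulrCA -expRD rE exprVn; congr (_ * expR _).
  by rewrite /r; ring.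
Qed.

Lemma flat_le0 m (x : R) : x <= 0 -> flat m x = 0.
Proof. by move=> x0; rewrite /flat ltNge x0. Qed.

Lemma expR_ge_quadratic (r : R) : 0 <= r -> 1 + r + r ^+ 2 / 2 <= expR r.
Proof.
move=> r0.
pose f (t : R) := expR t - (1 + t + t ^+ 2 / 2).
have fd (t : R) : is_derive t 1 f (expR t - (1 + t)).
  have h : is_derive t 1 (expR - (cst 1 + id + 2^-1 *: (@id R) ^+ 2))
      (expR t - (1 + t)).
    have d2 : is_derive t 1 (2^-1 *: (@id R) ^+ 2) t.
      apply: is_derive_eq (is_deriveZ _ (is_deriveX 2 (is_derive_id t 1))) _.
      by rewrite /GRing.scale/=; field.
    have d1 := is_deriveD (is_derive_cst (1 : R) t 1) (is_derive_id t 1).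
    apply: is_derive_eq (is_deriveB (is_derive_expR t) (is_deriveD d1 d2)) _.
    by rewrite add0r.
  have -> // : f = expR - (cst 1 + id + 2^-1 *: (@id R) ^+ 2).
  by apply/funext => u; rewrite /f !fctE /GRing.scale/= (mulrC 2^-1).
have [|c /itvP cr] := @MVT_segment _ f (fun t => expR t - (1 + t)) 0 r r0
  (fun t _ => fd t).
  by apply: derivable_within_continuous => u _; have [] := fd u.
rewrite /f expR0 expr0n/= mul0r !addr0 subrr !subr0 => fE.
by rewrite -subr_ge0 fE mulr_ge0// subr_ge0 expR_ge1Dx.
Qed.

(** With [s = r / (1 + r)], this is [6 r <= (1 + r) exp (2 r)]. *)
Lemma bump_le (s : R) : 0 <= s -> 6 * s * (expR 1 * flat 0 (1 - s)) ^+ 2 <= 1.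
Proof.
move=> s0; have [s1|s1] := ltP s 1; last first.
  by rewrite flat_le0 ?subr_le0// mulr0 expr0n mulr0.
have [] := bumpE s1; move: (_ - 1) => r r1 sE -> _.
have r0 : 0 <= r by move: s0; rewrite sE pmulr_lge0// invr_gt0.
have e2 : 1 + (2 * r) + (2 * r) ^+ 2 / 2 <= expR (2 * r).
  by apply: expR_ge_quadratic; rewrite mulr_ge0.
rewrite sE expr2 -expRD -[- r - r]opprD expRN.
have -> : r + r = 2 * r by ring.
rewrite ler_pdivrMr ?expR_gt0// mul1r mulrA ler_pdivrMr//.
apply: le_trans (ler_wpM2r (ltW r1) e2).
have := sqr_ge0 (2 * r - 3 / 4); have := exprn_ge0 3 r0; nra.
Qed.

(** The coefficients [27/5], [9/10] and [11/5] are [6], [1] and [2] with a loss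
of ten percent. In terms of [r] and after clearing denominators, this is the
nonnegativity of
[(27/5 r - 8/15 (1 + r)) exp r + (1 + r) (9/10 - 11/5 r (1 + r))]. If the
coefficient of [exp r] is nonnegative, the quadratic lower bound of [exp r]
suffices. Otherwise [r <= 1/9], and [exp r] is bounded above by [9/8]. *)
Lemma bump_drop (s : R) : 0 <= s ->
  8 / 15 <= 27 / 5 * s + 9 / 10 * (expR 1 * flat 0 (1 - s))
            - 11 / 5 * s * (expR 1 * flat 2 (1 - s)).
Proof.
move=> s0; have [s1|s1] := ltP s 1; last first.
  by rewrite !flat_le0 ?subr_le0// !mulr0 addr0 subr0; lra.
have [] := bumpE s1; move: (_ - 1) => r r1 sE -> ->.
have r0 : 0 <= r by move: s0; rewrite sE pmulr_lge0// invr_gt0.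
have e2 := expR_ge_quadratic r0.
rewrite sE expRN; set E := expR r in e2 *.
have E0 : 0 < E by exact: expR_gt0.
rewrite -subr_ge0.
have -> : 27 / 5 * (r / (1 + r)) + 9 / 10 * E^-1 -
    11 / 5 * (r / (1 + r)) * ((1 + r) ^+ 2 * E^-1) - 8 / 15 =
  (27 / 5 * r * E + (1 + r) * (9 / 10 - 11 / 5 * r * (1 + r)) - 8 / 15 * (1 + r) * E)
    / ((1 + r) * E).
  by field; rewrite !lt0r_neq0.
rewrite divr_ge0//; last by rewrite mulr_ge0 ?ltW.
have [h|h] := leP 0 (27 / 5 * r - 8 / 15 * (1 + r)).
  have := ler_wpM2l h e2; have := exprn_ge0 3 r0; have := exprn_ge0 2 r0; nra.
have r9 : r <= 1 / 9 by lra.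
have := expR_ge1Dx (- r); rewrite expRN -/E => h2.
have E98 : E <= 9 / 8.
  have := ler_wpM2r (ltW E0) h2; rewrite mulVf ?lt0r_neq0//; nra.
nra.
Qed.

End FlatFunction.

(** * Bilinear forms and second-order expansions *)

Section BilinearForm.
Context (R : realType) (n : nat).
Implicit Types (S : 'M[R]_n) (z w : 'rV[R]_n) (a : R).

Definition bform S z w : R := (z *m S *m w^T) 0 0.

Lemma bformE S z w : bform S z w = \sum_j (z *m S) 0 j * w 0 j.
Proof. by rewrite /bform mxE; apply: eq_bigr => j _; rewrite [_^T _ _]mxE. Qed.

Lemma bformDl S z z' w : bform S (z + z') w = bform S z w + bform S z' w.
Proof. by rewrite /bform !mulmxDl mxE. Qed.

Lemma bformDr S z w w' : bform S z (w + w') = bform S z w + bform S z w'.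
Proof. by rewrite /bform raddfD mulmxDr mxE. Qed.

Lemma bformZl S a z w : bform S (a *: z) w = a * bform S z w.
Proof. by rewrite /bform -!scalemxAl mxE. Qed.

Lemma bformZr S a z w : bform S z (a *: w) = a * bform S z w.
Proof. by rewrite /bform linearZ -scalemxAr mxE. Qed.

Lemma bform_scale S a z w : bform (a *: S) z w = a * bform S z w.
Proof. by rewrite /bform -scalemxAr -scalemxAl mxE. Qed.

Lemma bformC S z w : S^T = S -> bform S z w = bform S w z.
Proof.
by move=> sS; rewrite /bform -[in LHS]trace_mx11 -mxtrace_tr !trmx_mul trmxK sS
  mulmxA trace_mx11.
Qed.

Lemma bform_sym S : (forall z w, bform S z w = bform S w z) -> S^T = S.
Proof.
move=> sS; apply/matrixP => i j; have := sS (delta_mx 0 j) (delta_mx 0 i).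
by rewrite /bform !trmx_delta -!rowE -!colE !mxE.
Qed.

Lemma bform_cauchy_schwarz S z w : S^T = S -> (forall v, 0 <= bform S v v) ->
  bform S z w ^+ 2 <= bform S z z * bform S w w.
Proof.
move=> sS S0; have P (a : R) :
    0 <= bform S z z + 2 * a * bform S z w + a ^+ 2 * bform S w w.
  have := S0 (z + a *: w).
  rewrite !(bformDl, bformDr, bformZl, bformZr) (bformC w z sS).
  by congr (_ <= _); ring.
have [w0|w0] := eqVneq (bform S w w) 0.
  have [->|zw0] := eqVneq (bform S z w) 0; first by rewrite w0 mulr0 expr0n.
  have := P (- (bform S z z + 1) / (2 * bform S z w)).
  have -> : 2 * (- (bform S z z + 1) / (2 * bform S z w)) * bform S z w
    = - (bform S z z + 1) by field.
  by rewrite w0 mulr0 addr0 opprD addNKr oppr_ge0 ler10.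
have wp : 0 < bform S w w by rewrite lt_neqAle eq_sym w0 S0.
have := P (- bform S z w / bform S w w).
have -> : bform S z z + 2 * (- bform S z w / bform S w w) * bform S z w +
    (- bform S z w / bform S w w) ^+ 2 * bform S w w =
  (bform S z z * bform S w w - bform S z w ^+ 2) / bform S w w by field.
by rewrite pmulr_lge0 ?invr_gt0// subr_ge0.
Qed.

Lemma ler_mx_coord z j : `|z 0 j| <= `|z|.
Proof.
rewrite [leRHS]/Num.Def.normr /= mx_normrE.
by apply/bigmax_geP; right; exists (0, j).
Qed.

Lemma mx_norm_le (C : R) z : 0 <= C -> (forall j, `|z 0 j| <= C) -> `|z| <= C.
Proof.
move=> C0 zC; rewrite [leLHS]/Num.Def.normr /= mx_normrE.
by apply/bigmax_leP; split=> // -[i j] _; rewrite (ord1 i)/=; exact: zC.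
Qed.

Lemma bform_norm_le S : exists2 C, 0 < C &
  forall z w, `|bform S z w| <= C * `|z| * `|w|.
Proof.
exists (\sum_i \sum_j `|S i j| + 1).
  by rewrite ltr_wpDl// sumr_ge0// => i _; rewrite sumr_ge0.
move=> z w; apply: (@le_trans _ _ ((\sum_i \sum_j `|S i j|) * `|z| * `|w|)); last first.
  by rewrite -!mulrA ler_wpM2r ?mulr_ge0// lerDl.
rewrite bformE; apply: le_trans (ler_norm_sum _ _ _) _.
rewrite exchange_big -mulrA mulr_suml; apply: ler_sum => j _.
rewrite normrM mulrA; apply: ler_pM => //; last exact: ler_mx_coord.
rewrite mxE; apply: le_trans (ler_norm_sum _ _ _) _.
rewrite mulr_suml; apply: ler_sum => i _.
by rewrite normrM mulrC ler_wpM2l// ler_mx_coord.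
Qed.

(** By Cauchy-Schwarz each entry of [z *m S] is bounded by a multiple of
[sqrt (bform S z z)], and [z] is recovered from [z *m S] by the inverse of [S].
This gives definiteness and coercivity at once. *)
Lemma bform_coercive S : S^T = S -> S \in unitmx ->
  (forall v, 0 <= bform S v v) ->
  exists2 C, 0 < C & forall z, `|z| ^+ 2 <= C * bform S z z.
Proof.
move=> sS uS S0.
have [K K0 KS] : exists2 K, 0 < K & forall v : 'rV[R]_n, `|v *m invmx S| <= K * `|v|.
  exists (\sum_i \sum_j `|invmx S i j| + 1).
    by rewrite ltr_wpDl// sumr_ge0// => i _; rewrite sumr_ge0.
  move=> v; apply: mx_norm_le => [|j].
    by rewrite mulr_ge0// addr_ge0// sumr_ge0// => i _; rewrite sumr_ge0.
  rewrite mxE; apply: le_trans (ler_norm_sum _ _ _) _.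
  rewrite mulrDl mul1r ler_wpDr// mulr_suml; apply: ler_sum => i _.
  rewrite normrM mulrC ler_pM//; last exact: ler_mx_coord.
  by rewrite (bigD1 j)//= lerDl sumr_ge0.
pose t := \sum_j bform S (delta_mx 0 j) (delta_mx 0 j).
have t0 : 0 <= t by apply: sumr_ge0 => j _; exact: S0.
exists (K ^+ 2 * t + 1) => [|z]; first by rewrite ltr_wpDl// mulr_ge0// sqr_ge0.
rewrite mulrDl mul1r ler_wpDr//.
have zS : `|z *m S| <= Num.sqrt (t * bform S z z).
  apply: mx_norm_le => [|j]; first exact: sqrtr_ge0.
  rewrite -sqrtr_sqr ler_wsqrtr//.
  have -> : (z *m S) 0 j = bform S z (delta_mx 0 j).
    by rewrite /bform trmx_delta -colE !mxE.
  apply: le_trans (bform_cauchy_schwarz z _ sS S0) _.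
  rewrite mulrC ler_wpM2r// /t (bigD1 j)//= lerDl sumr_ge0//.
have zK : `|z| <= K * `|z *m S| by have := KS (z *m S); rewrite mulmxK.
apply: le_trans (_ : (K * `|z *m S|) ^+ 2 <= _).
  by rewrite ler_sqr ?nnegrE// mulr_ge0// ltW.
rewrite exprMn -mulrA ler_wpM2l ?sqr_ge0// -[leRHS]sqr_sqrtr ?mulr_ge0//.
by rewrite ler_sqr ?nnegrE// sqrtr_ge0.
Qed.

End BilinearForm.

Section Neighbourhoods.
Context (R : realType) (V : normedModType R).

Lemma near0_ball (P : V -> Prop) : (\forall z \near (0 : V), P z) ->
  exists2 r, 0 < r & forall z, `|z| < r -> P z.
Proof.
move=> /nbhs_ballP[r /= r0 rP]; exists r => // z zr; apply: rP.
by rewrite -ball_normE /= sub0r normrN.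
Qed.

Lemma near0_shift (u : V) (P : V -> Prop) : (\forall v \near u, P v) ->
  \forall z \near (0 : V), P (z + u).
Proof. by rewrite (near_shift 0); apply: filterS => z /=; rewrite subr0. Qed.

Lemma is_derive_segment (h : V -> R) (p w : V) (t : R) :
  differentiable h (p + t *: w) ->
  is_derive t 1 (fun s => h (p + s *: w)) ('d h (p + t *: w) w).
Proof.
move=> dh.
have dk : is_diff t (fun s : R => p + s *: w) (fun s => s *: w).
  have [d1 d2] := is_diffD (is_diff_cst p t) (is_diff_scalel t w).
  by split; [exact: d1|rewrite [LHS]d2; apply/funext => s; rewrite fctE add0r].
have [dc dcE] := is_diff_comp dk (differentiableP dh).
apply: DeriveDef; first exact: diff_derivable.
by rewrite deriveE// dcE /= scale1r.
Qed.

End Neighbourhoods.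

Lemma hessian_row (R : realType) n (h : 'rV[R]_n -> R) (u0 z : 'rV[R]_n) j :
  (z *m hessian h u0) 0 j = 'd (fun v => 'd h v (delta_mx 0 j : 'rV[R]_n)) u0 z.
Proof.
rewrite [in RHS](row_sum_delta z) linear_sum mxE.
by apply: eq_bigr => i _; rewrite linearZ mxE.
Qed.

Section SecondOrder.
Context (R : realType) (n : nat) (A : set 'rV[R]_n) (h : 'rV[R]_n -> R).
Variable u0 : 'rV[R]_n.
Hypotheses (A_open : open A) (Au0 : A u0) (h_smooth : smooth_on A h).
Hypothesis h_crit : forall w, 'd h u0 w = 0.

Local Notation H := (hessian h u0).

(** The estimate is made uniform in the direction [w] by expanding [w] in the
canonical basis, hence the constant [e / (n + 1)]. *)
Lemma diff_near_critical (e : R) : 0 < e ->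
  \forall z \near (0 : 'rV[R]_n),
    forall w, `|'d h (z + u0) w - bform H z w| <= e * `|z| * `|w|.
Proof.
move=> e0; pose e' := e / (n%:R + 1).
have n0 : 0 < n%:R + 1 :> R by rewrite ltr_wpDl.
have e'0 : 0 < e' by rewrite divr_gt0.
pose D j v := 'd h v (delta_mx 0 j : 'rV[R]_n) : R.
have dD j : differentiable (D j) u0.
  by apply: smooth_on_differentiable Au0; exact: smooth_on_diff.
have DE j z : (z *m H) 0 j = D j u0 + 'd (D j) u0 z.
  have Du0 : D j u0 = 0 by exact: h_crit.
  by rewrite Du0 [RHS]add0r; exact: hessian_row.
have nD : \forall z \near (0 : 'rV[R]_n),
    forall j, `|D j (z + u0) - (z *m H) 0 j| <= e' * `|z|.
  have F := @filter_forall _ _ (fun (j : 'I_n) (z : 'rV[R]_n) =>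
    (`|D j (z + u0) - (z *m H) 0 j| <= e' * `|z| : Prop)) _
    (nbhs_filter (0 : 'rV[R]_n)).
  apply: F => j; apply: filterS (diff_le (dD j) e'0) => z.
  by rewrite DE opprD addrA.
apply: filterS nD => z zD w.
rewrite bformE {1}(row_sum_delta w) linear_sum -sumrB.
apply: le_trans (ler_norm_sum _ _ _) _.
apply: (@le_trans _ _ (\sum_(j < n) e' * `|z| * `|w|)).
  apply: ler_sum => j _; rewrite linearZZ [_ *: _]mulrC -mulrBl normrM.
  by apply: ler_pM => //; [exact: zD|exact: ler_mx_coord].
rewrite sumr_const card_ord -mulr_natl !mulrA; do 2 apply: ler_wpM2r => //.
by rewrite ler_pdivrMr// mulrC ler_wpM2l ?lerDl// ltW.
Qed.

(** Mean value theorem on the segment from [u0 + z] to [u0 + z + w]. Keeping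
[z] free, instead of expanding at [u0] only, is what makes the symmetry of the
Hessian a consequence. *)
Lemma taylor2_critical (e : R) : 0 < e -> exists2 r, 0 < r &
  forall z w, `|z| < r -> `|w| < r ->
    `|h (z + w + u0) - h (z + u0) - bform H z w - bform H w w / 2|
      <= e * (`|z| + `|w|) * `|w|.
Proof.
move=> e0.
have [r r0 rP] : exists2 r, 0 < r & forall z, `|z| < r ->
    A (z + u0) /\ forall w, `|'d h (z + u0) w - bform H z w| <= e * `|z| * `|w|.
  apply: near0_ball; apply: filterI; last exact: diff_near_critical.
  by apply: (@near0_shift _ _ u0 A); exact: open_nbhs_nbhs.
have r2 : 0 < r / 2 by rewrite divr_gt0.
exists (r / 2) => // z w zr wr.
have tP (t : R) : 0 <= t <= 1 -> `|z + t *: w| <= `|z| + `|w|.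
  move=> /andP[t0 t1]; apply: le_trans (ler_normD _ _) _; rewrite lerD2l normrZ.
  by rewrite ger0_norm// ler_piMl.
have tr (t : R) : 0 <= t <= 1 -> `|z + t *: w| < r.
  by move=> /tP /le_lt_trans -> //; rewrite (splitr r) ltrD.
pose f (t : R) : R :=
  h (z + u0 + t *: w) - (bform H z w *: t + (bform H w w / 2) *: t ^+ 2).
pose df t := 'd h (z + u0 + t *: w) w - bform H (z + t *: w) w.
have fd (t : R) : 0 <= t <= 1 -> is_derive t 1 f (df t).
  move=> t01.
  have d1 : is_derive t 1 (bform H z w *: @id R + (bform H w w / 2) *: (@id R) ^+ 2)
      (bform H (z + t *: w) w).
    apply: is_derive_eq (is_deriveD (is_deriveZ _ (is_derive_id t 1))
      (is_deriveZ _ (is_deriveX 2 (is_derive_id t 1)))) _.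
    by rewrite bformDl bformZl /GRing.scale/=; field.
  apply: is_deriveB d1; apply: is_derive_segment.
  apply: smooth_on_differentiable h_smooth _; rewrite addrAC.
  exact: (rP _ (tr t t01)).1.
have [||c /itvP cr] := @MVT_segment _ f df 0 1 ler01.
- by move=> t; rewrite in_itv/= => /andP[t0 t1]; apply: fd; rewrite !ltW.
- apply: derivable_within_continuous => t; rewrite in_itv/= => /fd.
  by case.
have c01 : 0 <= c <= 1 by rewrite !cr.
rewrite /f scale1r scale0r addr0 expr1n expr0n /= !scaler0 addr0 subr0 subr0.
rewrite /GRing.scale/= !mulr1 -(addrAC z w) => fE.
have -> : h (z + w + u0) - h (z + u0) - bform H z w - bform H w w / 2 = df c.
  by rewrite -fE; ring.
have := (rP _ (tr c c01)).2 w; rewrite (addrAC z _ u0) => /le_trans; apply.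
by rewrite ler_wpM2r// ler_wpM2l ?tP// ltW.
Qed.

(** The increment from [u0] to [u0 + z + w] can be expanded through [u0 + z] or
through [u0 + w]; the difference of the two expansions is
[bform H z w - bform H w z], up to an error which becomes negligible when [z]
and [w] are scaled by a small [s], both sides being divided by [s ^+ 2]. *)
Lemma hessian_sym : H^T = H.
Proof.
apply: bform_sym => z w; apply/eqP; rewrite -subr_eq0 -normr_le0.
apply/ler_addgt0Pr => e e0; rewrite add0r.
pose K := (`|z| + `|w|) * `|w| + `|z| * `|z| + ((`|w| + `|z|) * `|z| + `|w| * `|w|) + 1.
have K0 : 0 < K by rewrite ltr_wpDl// ?addr_ge0// mulr_ge0// ?addr_ge0.
have [r r0 rP] := taylor2_critical (divr_gt0 e0 K0).
pose s := r / (`|z| + `|w| + 1).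
have N0 : 0 < `|z| + `|w| + 1 by rewrite ltr_wpDl// addr_ge0.
have s0 : 0 < s by rewrite divr_gt0.
have sr (v : 'rV[R]_n) : `|v| <= `|z| + `|w| -> `|s *: v| < r.
  move=> vN; rewrite normrZ gtr0_norm// /s mulrAC ltr_pdivrMr// ltr_pM2l//.
  by rewrite (le_lt_trans vN)// ltrDl.
clearbody s.
have zr : `|s *: z| < r by apply: sr; rewrite lerDl.
have wr : `|s *: w| < r by apply: sr; rewrite lerDr.
have or : `|0 : 'rV[R]_n| < r by rewrite normr0.
have b0 v : bform H 0 v = 0 by rewrite -(scale0r 0) bformZl mul0r.
have := rP _ _ zr wr; have := rP _ _ or zr; have := rP _ _ wr zr; have := rP _ _ or wr.
rewrite !b0 !add0r !normr0 !add0r !subr0 (addrC (s *: w) (s *: z)).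
rewrite !(bformZl, bformZr) !normrZ (gtr0_norm s0) => h1 h2 h3 h4.
have eK : e / K * K = e by rewrite divfK ?lt0r_neq0.
have s2 : 0 < s ^+ 2 by rewrite exprn_gt0.
rewrite -(ler_pM2l s2) -{1}(gtr0_norm s2) -normrM.
have -> : s ^+ 2 * e = s ^+ 2 * (e / K * K) by rewrite eK.
move: (e / K) (divr_gt0 e0 K0) h1 h2 h3 h4 => c c_gt0; rewrite !ler_norml.
move: (h _) (h _) (h _) (h _) => p q a b.
move=> /andP[? ?] /andP[? ?] /andP[? ?] /andP[? ?]; rewrite /K.
have c0 : 0 <= s ^+ 2 * c by rewrite mulr_ge0// ltW.
by apply/andP; split; lra.
Qed.

Lemma hessian_max : (forall u, A u -> h u <= h u0) ->
  forall z, bform H z z <= 0.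
Proof.
move=> h_max z; apply/ler_addgt0Pr => e e0; rewrite add0r.
have K0 : 0 < 2 * `|z| ^+ 2 + 1 by rewrite ltr_wpDl// mulr_ge0// exprn_ge0.
have [r r0 rP] := taylor2_critical (divr_gt0 e0 K0).
have [r' r'0 r'P] := near0_ball
  (@near0_shift _ _ u0 A (open_nbhs_nbhs (conj A_open Au0))).
have m0 : 0 < Num.min r r' by rewrite lt_min r0.
have N0 : 0 < `|z| + 1 by rewrite ltr_wpDl.
pose s := Num.min r r' / (`|z| + 1).
have s0 : 0 < s by rewrite divr_gt0.
have : `|s *: z| < Num.min r r'.
  by rewrite normrZ gtr0_norm// /s mulrAC ltr_pdivrMr// ltr_pM2l// ltrDl.
clearbody s; rewrite lt_min => /andP[/(rP 0 _) + /r'P /h_max sz].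
have b0 : bform H 0 (s *: z) = 0 by rewrite -(scale0r 0) bformZl mul0r.
rewrite normr0 => /(_ r0); rewrite b0 !add0r !subr0 bformZl bformZr.
rewrite normrZ gtr0_norm// ler_norml => /andP[+ _].
have s2 : 0 < s ^+ 2 by rewrite exprn_gt0.
have eK : e / (2 * `|z| ^+ 2 + 1) * (2 * `|z| ^+ 2 + 1) = e.
  by rewrite divfK ?lt0r_neq0.
move: (e / _) (divr_gt0 e0 K0) eK => c c0 <- h1.
have sc : 0 <= s ^+ 2 * c by rewrite mulr_ge0// ltW.
by rewrite -(ler_pM2l s2); lra.
Qed.

End SecondOrder.

(** * Charts, smooth functions and Poisson brackets *)

Local Notation coord := Defs.coord.

Section Chart.
Context (R : realType) (n : nat) (M : topologicalType) (c : chart R n M).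
Implicit Types (y : M) (u : 'rV[R]_n) (O : set M).

Local Notation A := (coord c @` dom c).

Lemma param_dom u : A u -> dom c (param c u).
Proof. by move=> [y cy <-]; rewrite coordK. Qed.

Lemma paramK u : A u -> coord c (param c u) = u.
Proof. by move=> [y cy <-]; rewrite coordK. Qed.

Lemma coord_image O u :
  (coord c @` (dom c `&` O)) u <-> A u /\ O (param c u).
Proof.
split=> [[y [cy Oy] <-]|[[y cy <-]]]; first by rewrite coordK//; split=> //; exists y.
by rewrite coordK// => Oy; exists y.
Qed.

Lemma open_coord_image O : open O -> open (coord c @` (dom c `&` O)).
Proof.
move=> oO; rewrite openE => u /coord_image[Au Ou]; rewrite /interior.
have : \forall v \near u, A v /\ O (param c v).
  apply: filterI; first by apply: open_nbhs_nbhs; split=> //; exact: coord_open.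
  by apply: (param_continuous Au); apply: open_nbhs_nbhs.
by apply: filterS => v /coord_image.
Qed.

Lemma near_coord_param y (P : M -> Prop) : dom c y ->
  (\forall z \near y, P z) -> \forall u \near coord c y, P (param c u).
Proof.
move=> cy Py; apply: (param_continuous (c := c)); first by exists y.
by rewrite /nbhs /= coordK.
Qed.

Lemma near_param_coord y (P : 'rV[R]_n -> Prop) : dom c y ->
  (\forall u \near coord c y, P u) -> \forall z \near y, P (coord c z).
Proof. by move=> cy Py; apply: (Defs.coord_continuous cy). Qed.

End Chart.

Section SmoothFunctions.
Context (R : realType) (n : nat) (M : smoothManifold R n).
Implicit Types (f g h : M -> R) (y : M) (c : chart R n M).

Lemma chart_image_open c : open (coord c @` dom c).
Proof. exact: coord_open. Qed.

Lemma smoothD f g : smooth f -> smooth g -> smooth (fun y => f y + g y).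
Proof.
move=> fs gs c cA.
exact: (smooth_onD (@chart_image_open c) (fs c cA) (gs c cA)).
Qed.

Lemma smoothN f : smooth f -> smooth (fun y => - f y).
Proof.
move=> fs c cA; have oA := @chart_image_open c.
apply: (@eq_smooth_on _ _ _ _ (fun u => -1 * f (param c u))) => //.
  by move=> u _ /=; rewrite mulN1r.
by apply: smooth_onM => //; [exact: smooth_on_cst|exact: fs].
Qed.

Lemma smooth_differentiable c f y : atlas c -> dom c y -> smooth f ->
  differentiable (f \o param c) (coord c y).
Proof. by move=> cA cy fs; apply: smooth_on_differentiable (fs c cA) _; exists y. Qed.

Lemma smooth_continuous f : smooth f -> continuous f.
Proof.
move=> fs y; have cy := chart_at_dom y; set c := chart_at y in cy.
have cA : atlas c := chart_at_atlas y.
have fc := differentiable_continuous (smooth_differentiable cA cy fs).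
have : (f \o param c) \o coord c @ y --> f y.
  rewrite -[in X in _ --> X](coordK cy).
  by apply: continuous_comp => //; exact: Defs.coord_continuous.
apply: cvg_trans; apply: near_eq_cvg.
have : \forall z \near y, dom c z by apply: open_nbhs_nbhs; split=> //; exact: dom_open.
by apply: filterS => z cz /=; rewrite coordK.
Qed.

Lemma near_eq_differential c f g y : atlas c -> dom c y -> smooth f ->
  (\forall z \near y, f z = g z) ->
  differential_in c g y = differential_in c f y.
Proof.
move=> cA cy fs fg; apply/funext => w; rewrite /differential_in.
by have [_ ->] := near_eq_diff (smooth_differentiable cA cy fs)
  (near_coord_param cy fg).
Qed.

(** Smoothness of the extension by zero in any other chart is checked on the
overlap with the domain of [c] and on the complement of [K], which are open and
together cover everything. *)
Lemma smooth_extension c (K : set M) (v : 'rV[R]_n -> R) :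
  atlas c -> closed K -> K `<=` dom c ->
  smooth_on (coord c @` dom c) v ->
  (forall y, dom c y -> ~ K y -> v (coord c y) = 0) ->
  smooth (fun y => if y \in K then v (coord c y) else 0).
Proof.
move=> cA cK Kc vs v0 c' c'A.
apply: (@smooth_onS _ _ _
  (coord c' @` (dom c' `&` dom c) `|` coord c' @` (dom c' `&` ~` K))).
  move=> _ [y c'y <-]; have [Ky|nKy] := pselect (K y).
    by left; exists y => //; split=> //; exact: Kc.
  by right; exists y.
apply: smooth_onU.
  have oO : open (coord c' @` (dom c' `&` dom c)).
    by apply: open_coord_image; exact: dom_open.
  apply: (eq_smooth_on oO) (smooth_on_comp oO _ (atlas_compatible c'A cA) vs).
    move=> _ [y [c'y cy] <-] /=; rewrite coordK//; case: ifPn => // /negP nKy.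
    by apply: v0 => // Ky; apply: nKy; exact: mem_set.
  by move=> _ [y [c'y cy] <-] /=; rewrite coordK//; exists y.
have oO : open (coord c' @` (dom c' `&` ~` K)).
  by apply: open_coord_image; rewrite openC.
apply: (@eq_smooth_on _ _ _ _ (fun=> 0)) (smooth_on_cst _ 0) => //.
move=> _ [y [c'y nKy] <-] /=; rewrite coordK//; case: ifPn => // /set_mem //.
Qed.

End SmoothFunctions.

Section PoissonBracket.
Context (R : realType) (n : nat) (M : smoothManifold R n).
Variable omega : symplecticForm M.
Implicit Types (f g h : M -> R) (y : M) (c : chart R n M).

Local Notation pb := (poisson omega).
Local Notation vf := (hamiltonian_vf_in omega).

Lemma hamiltonian_vf_inE c h y : atlas c -> dom c y ->
  vf c h y = (\row_j differential_in c h y (delta_mx 0 j))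
             *m invmx (coef omega c (coord c y)).
Proof.
move=> cA cy; apply: hamiltonian_vf_in_unique => // w.
rewrite /form_in mulmxKV ?coef_nondegenerate// mxE.
rewrite {2}(row_sum_delta w) /differential_in linear_sum.
by apply: eq_bigr => j _; rewrite !mxE linearZ /= mulrC.
Qed.

Lemma smooth_hamiltonian_vf c h j : atlas c -> smooth h ->
  smooth_on (coord c @` dom c) (fun u => vf c h (param c u) 0 j).
Proof.
move=> cA hs; have oA := @chart_image_open _ _ _ c.
apply: (@eq_smooth_on _ _ _ _ (fun u => \sum_i
    'd (h \o param c) u (delta_mx 0 i) * invmx (coef omega c u) i j)) => //.
  move=> u Au; rewrite hamiltonian_vf_inE//; last exact: param_dom.
  rewrite paramK// mxE; apply: eq_bigr => i _; rewrite mxE.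
  by rewrite /differential_in paramK.
apply: smooth_on_sum => // i; apply: smooth_onM => //.
  by apply: smooth_on_diff; exact: hs.
apply: smooth_on_invmx => // [u Au|a b].
  by have := coef_nondegenerate omega cA (param_dom Au); rewrite paramK.
exact: coef_smooth.
Qed.

Lemma smooth_poisson f g : smooth f -> smooth g -> smooth (pb f g).
Proof.
move=> fs gs c cA; have oA := @chart_image_open _ _ _ c.
apply: (@eq_smooth_on _ _ _ _ (fun u => \sum_j
    vf c g (param c u) 0 j * 'd (f \o param c) u (delta_mx 0 j))) => //.
  move=> u Au /=; rewrite (poisson_chart omega cA (param_dom Au))//.
  rewrite /differential_in paramK// [in RHS](row_sum_delta (vf c g _)) linear_sum.
  by apply: eq_bigr => j _; rewrite linearZZ.
apply: smooth_on_sum => // j; apply: smooth_onM => //.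
  exact: smooth_hamiltonian_vf.
by apply: smooth_on_diff; exact: fs.
Qed.

Lemma poissonC f g y : pb f g y = - pb g f y.
Proof.
have cA := chart_at_atlas y; have cy := chart_at_dom y.
rewrite /poisson -!(hamiltonian_vf_inP omega _ cA cy) /form_in.
rewrite -[in LHS]trace_mx11 -mxtrace_tr !trmx_mul trmxK mulmxA trace_mx11.
by rewrite coef_skew// mulmxN mulNmx mxE.
Qed.

Lemma poissonNl f g y : smooth f -> pb (fun z => - f z) g y = - pb f g y.
Proof.
move=> fs; rewrite /poisson /differential_in.
have df := smooth_differentiable (chart_at_atlas y) (chart_at_dom y) fs.
exact: (congr1 (@^~ _) (diffN df)).
Qed.

Lemma poissonNr f g y : smooth g -> pb f (fun z => - g z) y = - pb f g y.
Proof.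
move=> gs; rewrite (poissonC f (fun z => - g z)) (poissonNl f y gs) (poissonC f g).
by [].
Qed.

Lemma near_eq_poissonl f f' g y : smooth f -> (\forall z \near y, f z = f' z) ->
  pb f' g y = pb f g y.
Proof.
move=> fs ff'; rewrite /poisson.
by rewrite (near_eq_differential (chart_at_atlas y) (chart_at_dom y) fs ff').
Qed.

End PoissonBracket.

(** * The perturbation in coordinates *)

Section Bump.
Context (R : realType) (n : nat).
Implicit Types (S : 'M[R]_n) (u v w X : 'rV[R]_n).

Lemma smooth_on_coord (A : set 'rV[R]_n) j :
  smooth_on A (fun u : 'rV[R]_n => u 0 j : R).
Proof.
have lf : linear (fun u : 'rV[R]_n => u 0 j : R) by move=> a u v; rewrite !mxE.
pose f : {linear 'rV[R]_n -> R} := HB.pack (fun u : 'rV[R]_n => u 0 j : R)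
  (GRing.isLinear.Build _ _ _ _ _ lf).
by apply: (@smooth_on_linear _ _ _ _ f); exact: coord_continuous.
Qed.

Lemma smooth_on_bform (V : normedModType R) (A : set V) S (z w : V -> 'rV[R]_n) :
  open A -> (forall j, smooth_on A (fun p => z p 0 j)) ->
  (forall j, smooth_on A (fun p => w p 0 j)) ->
  smooth_on A (fun p => bform S (z p) (w p)).
Proof.
move=> oA zA wA; apply: (@eq_smooth_on _ _ _ _
  (fun p => \sum_j (\sum_i z p 0 i * S i j) * w p 0 j)) => //.
  by move=> u _; rewrite bformE; apply: eq_bigr => j _; rewrite mxE.
apply: smooth_on_sum => // j; apply: smooth_onM => //.
apply: smooth_on_sum => // i; apply: smooth_onM => //; exact: smooth_on_cst.
Qed.

Lemma smooth_on_coord_shift (A : set 'rV[R]_n) u0 j : open A ->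
  smooth_on A (fun u => (u - u0) 0 j).
Proof.
move=> oA; apply: (@eq_smooth_on _ _ _ _ (fun u => u 0 j + (- u0) 0 j)) => //.
  by move=> u _; rewrite [RHS]mxE.
by apply: smooth_onD => //; [exact: smooth_on_coord|exact: smooth_on_cst].
Qed.

Lemma diff_bform_linear S u0 w u X :
  'd (fun v => bform S (v - u0) w) u X = bform S X w.
Proof.
have lf : linear (fun h => bform S h w) by move=> a h h'; rewrite bformDl bformZl.
pose f : {linear 'rV[R]_n -> R} := HB.pack (fun h => bform S h w)
  (GRing.isLinear.Build _ _ _ _ _ lf).
have cf : continuous f.
  move=> h; apply: (@smooth_on_bform 'rV[R]_n setT S id (cst w) openT _ _ 0%N) => // j.
    exact: smooth_on_coord.
  exact: smooth_on_cst.
have [|_ ->//] := @diff_intro _ _ _ (fun v => bform S (v - u0) w) f u cf.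
move=> e e0; near=> h; rewrite -(addrA h) (bformDl S h) addrK subrr normr0.
by rewrite mulr_ge0// ltW.
Unshelve. all: by end_near. Qed.

Lemma diff_bform_quadratic S u0 u X : S^T = S ->
  'd (fun v => bform S (v - u0) (v - u0)) u X = 2 * bform S (u - u0) X.
Proof.
move=> sS.
have lf : linear (fun h => 2 * bform S (u - u0) h).
  by move=> a h h'; rewrite bformDr bformZr mulrDr mulrCA.
pose f : {linear 'rV[R]_n -> R} := HB.pack (fun h => 2 * bform S (u - u0) h)
  (GRing.isLinear.Build _ _ _ _ _ lf).
have cf : continuous f.
  move=> h; apply: (@smooth_onM R 'rV[R]_n setT (cst 2) (bform S (u - u0))
    openT _ _ 0%N) => //.
    exact: smooth_on_cst.
  apply: (@smooth_on_bform 'rV[R]_n setT S (cst (u - u0)) id openT) => j.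
    exact: smooth_on_cst.
  exact: smooth_on_coord.
have [|_ ->//] := @diff_intro _ _ _ (fun v => bform S (v - u0) (v - u0)) f u cf.
move=> e e0; have [C C0 CS] := bform_norm_le S.
apply: filterS (@nbhs0_le _ _ _ (divr_gt0 e0 C0)) => h he.
rewrite -(addrA h) /= !(bformDl S h, bformDr S _ h) (bformC (u - u0) h sS).
have -> : bform S h h + bform S h (u - u0) + (bform S h (u - u0) +
    bform S (u - u0) (u - u0)) - bform S (u - u0) (u - u0) -
    2 * bform S h (u - u0) = bform S h h by ring.
apply: le_trans (CS _ _) _; rewrite ler_wpM2r//.
by rewrite mulrC -ler_pdivlMr.
Qed.

Variables (S : 'M[R]_n) (u0 xi : 'rV[R]_n) (D : R).
Hypotheses (S_sym : S^T = S) (S_ge0 : forall v, 0 <= bform S v v).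
Local Notation q := (bform S xi xi).
Hypotheses (q_gt0 : 0 < q) (D_gt0 : 0 < D).

Local Notation Q u := (bform S (u - u0) (u - u0)).

(** Along [xi], the linear factor makes the function decrease near the centre,
at the rate [D]; the cutoff brings it back to zero before [Q] exceeds [6 D]. *)
Definition slope_bump u : R :=
  - (D / q) * (bform S (u - u0) xi * (expR 1 * flat 0 (1 - Q u / (6 * D)))).

Lemma smooth_slope_bump : smooth_on setT slope_bump.
Proof.
have oT : open [set: 'rV[R]_n] := openT.
have sL : smooth_on setT (fun u => bform S (u - u0) xi).
  apply: smooth_on_bform => // j; first exact: smooth_on_coord_shift.
  exact: smooth_on_cst.
have sQ : smooth_on setT (fun u => Q u).
  by apply: smooth_on_bform => // j; exact: smooth_on_coord_shift.
apply: smooth_onM => //; first exact: smooth_on_cst.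
apply: smooth_onM => //; apply: smooth_onM => //; first exact: smooth_on_cst.
apply: smooth_on_flat => //; apply: smooth_onD => //; first exact: smooth_on_cst.
apply: (@eq_smooth_on _ _ _ _ (fun u => - (6 * D)^-1 * Q u)) => //.
  by move=> u _; rewrite mulNr mulrC.
by apply: smooth_onM => //; exact: smooth_on_cst.
Qed.

Lemma slope_bump_eq0 u : 6 * D <= Q u -> slope_bump u = 0.
Proof.
move=> QD; rewrite /slope_bump flat_le0 ?mulr0// subr_le0 ler_pdivlMr ?mul1r//.
by rewrite mulr_gt0.
Qed.

Lemma slope_bump_sqr_le u : q * slope_bump u ^+ 2 <= D ^+ 3.
Proof.
rewrite /slope_bump; set s := Q u / (6 * D); set b := expR 1 * _.
have s0 : 0 <= s by rewrite divr_ge0// mulr_ge0// ltW.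
have QE : Q u = 6 * s * D by rewrite /s; field; exact: lt0r_neq0.
have := bform_cauchy_schwarz (u - u0) xi S_sym S_ge0.
have := bump_le s0; rewrite -/b QE; move: (bform S _ xi) => l sb lq.
have -> : q * (- (D / q) * (l * b)) ^+ 2 = D ^+ 2 / q * (l ^+ 2 * b ^+ 2).
  by field; exact: lt0r_neq0.
have h : l ^+ 2 * b ^+ 2 <= q * D.
  apply: le_trans (ler_wpM2r (sqr_ge0 b) lq) _.
  have -> : 6 * s * D * q * b ^+ 2 = 6 * s * b ^+ 2 * (q * D) by ring.
  by rewrite ger_pMl// mulr_gt0.
have -> : D ^+ 3 = D ^+ 2 / q * (q * D) by field; exact: lt0r_neq0.
by rewrite ler_wpM2l// divr_ge0 ?sqr_ge0// ltW.
Qed.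

Lemma diff_slope_bump u X : 'd slope_bump u X =
  - (D / q) * (bform S X xi * (expR 1 * flat 0 (1 - Q u / (6 * D)))
    - bform S (u - u0) xi * bform S (u - u0) X / (3 * D)
      * (expR 1 * flat 2 (1 - Q u / (6 * D)))).
Proof.
pose L v := bform S (v - u0) xi.
pose s v := 1 - Q v / (6 * D).
have oT : open [set: 'rV[R]_n] := openT.
have sL : smooth_on setT L.
  apply: smooth_on_bform => // j; first exact: smooth_on_coord_shift.
  exact: smooth_on_cst.
have sQ : smooth_on setT (fun u => Q u).
  by apply: smooth_on_bform => // j; exact: smooth_on_coord_shift.
have dL : differentiable L u by exact: smooth_on_differentiable sL _.
have dQ : differentiable (fun v => Q v) u by exact: smooth_on_differentiable sQ _.
have sE : s = cst 1 - (6 * D)^-1 *: (fun v => Q v).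
  by apply/funext => v; rewrite /s !fctE /GRing.scale/= mulrC.
have ds : differentiable s u.
  rewrite sE; apply: differentiableB; first exact: differentiable_cst.
  exact: differentiableZ.
have dsE : 'd s u X = - (bform S (u - u0) X / (3 * D)).
  rewrite sE diffB//; last exact: differentiableZ.
  rewrite diff_cst diffZ//.
  transitivity (0 - (6 * D)^-1 * 'd (fun v => Q v) u X) => //.
  by rewrite diff_bform_quadratic//; field; exact: lt0r_neq0.
have [dF dFE] := diff_flat 0 X ds.
pose F v := flat 0 (s v).
have bE : slope_bump = (- (D / q) * expR 1) *: (L * F).
  by apply/funext => v; rewrite /slope_bump !fctE /GRing.scale/= /L /F /s; ring.
have dLF : differentiable (L * F) u by exact: differentiableM.
rewrite bE; apply: etrans (congr1 (@^~ X) (diffZ _ dLF)) _.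
transitivity (- (D / q) * expR 1 * (L u * 'd F u X + F u * 'd L u X)).
  have dLFX := congr1 (@^~ X) (diffM dL dF).
  by apply: (congr1 (fun t => - (D / q) * expR 1 * t)); exact: dLFX.
by rewrite diff_bform_linear dFE mul0r subr0 dsE /L /F /s; ring.
Qed.

(** For [X = xi] the two hypotheses hold with constant 1; the margin allows [X]
to be the value, at a nearby point, of a vector field equal to [xi] at [u0].
The two occurrences of [X] in [diff_slope_bump] are bounded by the first
hypothesis and by Cauchy-Schwarz, respectively, which leaves [bump_drop]. *)
Lemma diff_slope_bump_le u X :
  9 / 10 * q <= bform S X xi -> bform S X X <= (11 / 10) ^+ 2 * q ->
  'd slope_bump u X - 9 / 10 * Q u <= - (8 / 15 * D).
Proof.
move=> Xxi XX; rewrite diff_slope_bump; set s := Q u / (6 * D).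
have s0 : 0 <= s by rewrite divr_ge0// mulr_ge0// ltW.
have QE : Q u = 6 * s * D by rewrite /s; field; exact: lt0r_neq0.
have := bump_drop s0.
set b := expR 1 * flat 0 _; set b2 := expR 1 * flat 2 _.
have b0 : 0 <= b by rewrite mulr_ge0 ?expR_ge0 ?flat_ge0.
have b20 : 0 <= b2 by rewrite mulr_ge0 ?expR_ge0 ?flat_ge0.
have h : bform S (u - u0) xi * bform S (u - u0) X <= 11 / 10 * q * Q u.
  have := bform_cauchy_schwarz (u - u0) xi S_sym S_ge0.
  have := bform_cauchy_schwarz (u - u0) X S_sym S_ge0.
  have := S_ge0 (u - u0); move: (Q u) (bform _ _ X) (bform _ _ xi) => Qu m l Q0 hm hl.
  apply: le_trans (ler_norm _) _.
  have c0 : 0 <= 11 / 10 * q by rewrite mulr_ge0 ?(ltW q_gt0)// divr_ge0.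
  have r0 : 0 <= 11 / 10 * q * Qu by rewrite mulr_ge0.
  rewrite -ler_sqr ?nnegrE//.
  rewrite real_normK ?num_real// exprMn.
  apply: le_trans (ler_pM (sqr_ge0 _) (sqr_ge0 _) hl hm) _.
  have -> : (11 / 10 * q * Qu) ^+ 2 = Qu * q * (Qu * ((11 / 10) ^+ 2 * q)) by ring.
  by rewrite ler_wpM2l ?mulr_ge0 ?(ltW q_gt0)// ler_wpM2l.
move: h Xxi; rewrite QE; move: (_ * bform _ _ X) (bform S X xi) => m l hm hl drop.
have -> : - (D / q) * (l * b - m / (3 * D) * b2) =
   - (l / q * b * D) + m / q / 3 * b2 by field; rewrite !lt0r_neq0.
have hl' : 9 / 10 * (b * D) <= l / q * b * D.
  by rewrite -[leRHS]mulrA ler_wpM2r ?(mulr_ge0 b0 (ltW D_gt0))// ler_pdivlMr.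
have hm' : m / q / 3 * b2 <= 11 / 5 * s * b2 * D.
  have -> : 11 / 5 * s * b2 * D = 11 / 10 * (6 * s * D) / 3 * b2 by field.
  rewrite ler_wpM2r// ler_wpM2r ?invr_ge0// ler_pdivrMr//.
  by apply: le_trans hm _; rewrite le_eqVlt; apply/orP; left; apply/eqP; ring.
have := ler_wpM2r (ltW D_gt0) drop; lra.
Qed.

End Bump.

(** * Lowering the maximum of the bracket *)

(** The set is the continuous image of a compact ball, hence compact, and the
space is Hausdorff. *)
Lemma closed_coord_ball (R : realType) n (M : topologicalType)
    (c : chart R n M) (u0 : 'rV[R]_n) (r : R) :
  hausdorff_space M -> 0 < r ->
  (forall u, `|u - u0| <= r -> (coord c @` dom c) u) ->
  closed [set y | dom c y /\ `|coord c y - u0| <= r].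
Proof.
move=> hM r0 rA; apply: compact_closed => //.
have -> : [set y | dom c y /\ `|coord c y - u0| <= r] =
    param c @` [set u | `|u - u0| <= r].
  apply/seteqP; split=> [y [cy yr]|_ [u ur <-]].
    by exists (coord c y) => //; rewrite coordK.
  have Au := rA u ur; split; first exact: param_dom.
  by rewrite paramK.
apply: continuous_compact.
  apply: continuous_in_subspaceT => u /set_mem/rA Au.
  exact: param_continuous.
apply: bounded_closed_compact.
  exists (`|u0| + r); split; first exact: num_real.
  move=> t tr u /= ur; apply: le_trans (ltW tr).
  by rewrite -[u](subrK u0) addrC (le_trans (ler_normD _ _))// lerD2l.
have -> : [set u | `|u - u0| <= r] = closed_ball u0 r.
  rewrite closed_ballE//; apply/funext => u /=.
  by rewrite /closed_ball_ /= distrC.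
exact: closed_ball_closed.
Qed.

Lemma max_gap (R : realType) (T : topologicalType) (h : T -> R) (x : T)
    (U V : set T) :
  compact (closure U) -> continuous h -> nbhs x V ->
  (forall y, closure U y -> y <> x -> h y < h x) ->
  exists2 d, 0 < d & forall y, U y -> ~ V y -> h y <= h x - d.
Proof.
move=> cU ch Vx hU.
pose K := closure U `&` ~` interior V.
have cK : compact K.
  by apply: compact_closedI => //; rewrite closedC; exact: open_interior.
have UK y : U y -> ~ V y -> K y.
  move=> Uy nVy; split; first exact: subset_closure.
  by move=> Vy; apply: nVy; exact: interior_subset.
have [K0|K0] := pselect (K !=set0); last first.
  exists 1 => // y Uy nVy; exfalso; apply: K0; exists y; exact: UK.
have [z /set_mem[Uz nVz] zmax] := compact_EVT_max K0 cK (continuous_subspaceT ch).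
exists (h x - h z).
  by rewrite subr_gt0; apply: hU => // zx; apply: nVz; rewrite zx.
by move=> y Uy nVy; rewrite subKr; apply/zmax/mem_set/UK.
Qed.

Lemma taylor_margin (R : realFieldType) (C a b p m : R) :
  0 < C -> a ^+ 2 <= C * (- 2^-1 * b) ->
  p - m - b / 2 <= (10 * C)^-1 * a * a -> p <= m - 9 / 10 * (- 2^-1 * b).
Proof.
move=> C0 aCb pm.
have : (10 * C)^-1 * a * a <= - 2^-1 * b / 10.
  rewrite -mulrA -expr2 mulrC ler_pdivrMr ?mulr_gt0//.
  by have -> : - 2^-1 * b / 10 * (10 * C) = C * (- 2^-1 * b) by field.
lra.
Qed.

Lemma ler_sub_add (R : numDomainType) (a b c d e : R) :
  a <= b - c -> d - c <= - e -> a + d <= b - e.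
Proof.
move=> ab dc; have -> : a + d = (a + c) + (d - c) by ring.
by apply: lerD => //; rewrite -lerBrDr.
Qed.

Section Perturbation.
Context (R : realType) (n : nat) (M : smoothManifold R n).
Variable omega : symplecticForm M.
Implicit Types (f g h : M -> R).

Local Notation pb := (poisson omega).
Local Notation vf := (hamiltonian_vf_in omega).

Section AtPoint.
Variable x : M.
Local Notation c := (chart_at x).
Local Notation u0 := (coord c x).
Local Notation A := (coord c @` dom c).

Let cA : atlas c := chart_at_atlas x.
Let cx : dom c x := chart_at_dom x.
Let A_open : open A := @coord_open _ _ _ c.
Let Au0 : A u0. Proof. by exists x. Qed.

(** In coordinates [{h, a} = sum_j Y_j d_j h] with [Y = X_a]. When this is
differentiated at a critical point of [h], the terms with derivatives of the
[Y_j] vanish. *)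
Lemma poisson_poisson_critical h a b : smooth h -> smooth a ->
  (forall w, differential_in c h x w = 0) ->
  pb (pb h a) b x = bform (hessian (h \o param c) u0) (vf c b x) (vf c a x).
Proof.
move=> hs sa hx; set xi := vf c b x.
pose D j u := 'd (h \o param c) u (delta_mx 0 j : 'rV[R]_n) : R.
pose Y j u := vf c a (param c u) 0 j : R.
have Ds j : smooth_on A (D j) by apply: smooth_on_diff; exact: hs.
have Ys j : smooth_on A (Y j) by exact: smooth_hamiltonian_vf.
have DY j : is_derive u0 xi (Y j * D j) (vf c a x 0 j * 'd (D j) u0 xi).
  have dY : is_derive u0 xi (Y j) ('D_xi (Y j) u0).
    by apply/derivableP/diff_derivable; exact: smooth_on_differentiable (Ys j) Au0.
  have dD : is_derive u0 xi (D j) ('d (D j) u0 xi).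
    have dDu : differentiable (D j) u0 by exact: smooth_on_differentiable (Ds j) Au0.
    by apply: DeriveDef; [exact: diff_derivable|rewrite deriveE].
  apply: is_derive_eq (is_deriveM dY dD) _.
  have -> : D j u0 = 0 by exact: hx.
  by rewrite scale0r addr0 /Y coordK.
have [dG GE] := is_derive_sum DY.
pose G : 'rV[R]_n -> R := \sum_(j < n) (Y j * D j).
have Gs : smooth_on A G.
  apply: (@eq_smooth_on _ _ _ _ (fun u => \sum_(j < n) Y j u * D j u)) => //.
    by move=> u _; rewrite /G fct_sumE.
  by apply: smooth_on_sum => // j; apply: smooth_onM.
have dGu : differentiable G u0 by exact: smooth_on_differentiable Gs Au0.
have Gpb : \forall u \near u0, G u = (pb h a \o param c) u.
  apply: filterS (open_nbhs_nbhs (conj A_open Au0)) => u Au.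
  rewrite /G fct_sumE /= (poisson_chart omega cA (param_dom Au))//.
  rewrite /differential_in paramK// [in RHS](row_sum_delta (vf c a _)) linear_sum.
  by apply: eq_bigr => j _; rewrite linearZZ.
rewrite {1}/poisson -/xi /differential_in.
have [_ ->] := near_eq_diff dGu Gpb.
rewrite -deriveE// GE bformE; apply: eq_bigr => j _.
by rewrite mulrC hessian_row.
Qed.

Variables (f g h : M -> R) (U : set M).
Hypotheses (f_smooth : smooth f) (g_smooth : smooth g).
Hypothesis hE : h = pb f g.
Hypothesis h_max : forall y, h y <= h x.
Hypothesis h_nondegenerate : nondegenerate_critical h x.
Hypotheses (Ux : nbhs x U) (U_compact : compact (closure U)).
Hypothesis h_lt : forall y, closure U y -> y <> x -> h y < h x.

Local Notation hc := (h \o param c).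
Local Notation S := (- 2^-1 *: hessian hc u0).
Local Notation q := (bform S (vf c g x) (vf c g x)).

Let h_smooth : smooth h. Proof. by rewrite hE; exact: smooth_poisson. Qed.

Let hc_smooth : smooth_on A hc. Proof. exact: h_smooth. Qed.

Let hc_crit w : 'd hc u0 w = 0. Proof. exact: h_nondegenerate.1. Qed.

Let hcE : hc u0 = h x. Proof. by rewrite /= coordK. Qed.

Let S_sym : S^T = S.
Proof. by rewrite linearZ /= (hessian_sym A_open Au0 hc_smooth hc_crit). Qed.

Let S_ge0 w : 0 <= bform S w w.
Proof.
rewrite bform_scale mulNr oppr_ge0 pmulr_rle0 ?invr_gt0//.
by apply: (hessian_max A_open Au0 hc_smooth hc_crit) => u _; rewrite hcE; exact: h_max.
Qed.

Let S_unit : S \in unitmx.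
Proof. by rewrite unitmxZ ?h_nondegenerate.2// unitfE oppr_eq0 invr_eq0. Qed.

Let poisson_poisson_max : - pb (pb h g) g x = 2 * q.
Proof.
rewrite poisson_poisson_critical// bform_scale mulrA mulrN divff// mulN1r//.
Qed.

Lemma poisson_poisson_ge0 : 0 <= - pb (pb h g) g x.
Proof. by rewrite poisson_poisson_max mulr_ge0. Qed.

(** The constant [(10 C)^-1], with [C] the coercivity constant, makes the Taylor
remainder at most a tenth of the quadratic form; the bounds on [X_g] hold near
the centre by continuity, as [q] is positive. *)
Let adapted_ball : 0 < q -> exists2 r, 0 < r & forall w, `|w| <= r ->
  let u := w + u0 in let X := vf c g (param c u) in
  [/\ A u, U (param c u), h (param c u) <= h x - 9 / 10 * bform S w w,
      9 / 10 * q <= bform S X (vf c g x) & bform S X X <= (11 / 10) ^+ 2 * q].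
Proof.
move=> q0; have [C C0 CS] := bform_coercive S_sym S_unit S_ge0.
have e0 : 0 < (10 * C)^-1 by rewrite invr_gt0 mulr_gt0.
have [r1 r10 r1P] := taylor2_critical A_open Au0 hc_smooth hc_crit e0.
have Xs j : smooth_on A (fun u => vf c g (param c u) 0 j).
  exact: smooth_hamiltonian_vf.
pose X u := vf c g (param c u).
have Xu0 : X u0 = vf c g x by rewrite /X coordK.
have sX : smooth_on A (fun u => bform S (X u) (vf c g x)).
  exact: (smooth_on_bform (w := fun=> vf c g x) _ A_open Xs
    (fun j => smooth_on_cst _ _)).
have sXX : smooth_on A (fun u => bform S (X u) (X u)).
  exact: (smooth_on_bform _ A_open Xs Xs).
have nX : \forall u \near u0, 9 / 10 * q < bform S (X u) (vf c g x).
  by apply: (cvgr_gt _ (smooth_on_continuous sX Au0)); rewrite Xu0; lra.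
have nXX : \forall u \near u0, bform S (X u) (X u) < (11 / 10) ^+ 2 * q.
  by apply: (cvgr_lt _ (smooth_on_continuous sXX Au0)); rewrite Xu0; lra.
have nU : \forall u \near u0, U (param c u) := near_coord_param (P := U) cx Ux.
have nA : \forall u \near u0, A u := open_nbhs_nbhs (conj A_open Au0).
have [r2 r20 r2P] := near0_ball (near0_shift (u := u0)
  (P := fun u => (A u /\ U (param c u)) /\
    (9 / 10 * q < bform S (X u) (vf c g x) /\
     bform S (X u) (X u) < (11 / 10) ^+ 2 * q))
  (filterI (filterI nA nU) (filterI nX nXX))).
have m0 : 0 < Num.min r1 r2 by rewrite lt_min r10.
exists (Num.min r1 r2 / 2) => [|w wr]; first by rewrite divr_gt0.
have : `|w| < Num.min r1 r2 by apply: le_lt_trans wr _; lra.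
rewrite lt_min => /andP[wr1 /r2P[[Au Uu] [/ltW Xu /ltW XXu]]] /=.
split; [exact: Au|exact: Uu| |exact: Xu|exact: XXu].
have := r1P 0 w; rewrite normr0 => /(_ r10 wr1).
have b0 : bform (hessian hc u0) 0 w = 0 by rewrite -(scale0r 0) bformZl mul0r.
rewrite b0 !add0r subr0 hcE ler_norml => /andP[_ hw].
by have := CS w; rewrite bform_scale => /taylor_margin; apply.
Qed.

(** The bound [D0] ensures that the support of the perturbation, where
[bform S w w <= 6 D], lies in [V], and that the gap of [h] outside [V] exceeds
[D]. *)
Lemma lower_maximum : 0 < - pb (pb h g) g x ->
  exists V : set M, [/\ nbhs x V, closed V, V `<=` U &
    exists2 D0, 0 < D0 & forall D eps : R, 0 < D < D0 -> 0 <= eps ->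
      2 * D ^+ 3 = - pb (pb h g) g x * eps ^+ 2 ->
      exists F, [/\ smooth F, forall y, `|F y - f y| <= eps,
        forall y, U y -> pb F g y <= h x - 8 / 15 * D &
        forall y, ~ V y -> F y = f y]].
Proof.
rewrite poisson_poisson_max pmulr_rgt0// => q0.
have [C C0 CS] := bform_coercive S_sym S_unit S_ge0.
have [r r0 rP] := adapted_ball q0.
pose V : set M := [set y | dom c y /\ `|coord c y - u0| <= r].
have uP u : `|u - u0| <= r -> A u.
  by move=> ur; have [+ _ _ _ _] := rP _ ur; rewrite subrK; exact.
have cV : closed V := closed_coord_ball (@carrier_hausdorff _ _ M) r0 uP.
have Vx : nbhs x V.
  have dx : \forall y \near x, dom c y.
    by apply: open_nbhs_nbhs; split=> //; exact: dom_open.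
  have ur : \forall u \near u0, `|u - u0| <= r.
    apply: filterS (nbhsx_ballx u0 r r0) => u.
    by rewrite -ball_normE /= distrC => /ltW.
  exact: (filterI dx (near_param_coord (P := fun u => `|u - u0| <= r) cx ur)).
have [d d0 dP] := max_gap U_compact (smooth_continuous h_smooth) Vx h_lt.
exists V; split; [exact: Vx|exact: cV| |].
  by move=> y [cy yr]; have [_ + _ _ _] := rP _ yr; rewrite subrK coordK//; exact.
exists (Num.min d (r ^+ 2 / (6 * C))).
  by rewrite lt_min d0 divr_gt0 ?exprn_gt0// mulr_gt0.
move=> D eps /andP[D0]; rewrite lt_min => /andP[Dd Dr] eps0 Deps.
have {}Deps : D ^+ 3 = q * eps ^+ 2 by lra.
pose v := slope_bump S u0 (vf c g x) D.
have vs : smooth_on setT v by exact: smooth_slope_bump.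
have v0 y : dom c y -> ~ V y -> v (coord c y) = 0.
  move=> cy nVy; apply: slope_bump_eq0 => //.
  (* by coercivity, the support of the perturbation lies in [V] *)
  rewrite leNgt; apply/negP => QD; apply: nVy; split=> //.
  rewrite -ler_sqr ?nnegrE ?(ltW r0)//; apply: le_trans (CS _) _.
  rewrite -ler_pdivlMl//; apply: le_trans (ltW QD) _.
  move: Dr; rewrite ltr_pdivlMr ?mulr_gt0// ler_pdivlMl//; lra.
pose F y := f y + (if y \in V then v (coord c y) else 0).
have Fs : smooth F.
  apply: smoothD => //; apply: smooth_extension => //; first by move=> y [].
  exact: smooth_onS vs.
exists F; split=> //.
- move=> y; rewrite /F addrC addKr; case: ifPn => _; last by rewrite normr0.
  rewrite -ler_sqr ?nnegrE// real_normK ?num_real//.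
  by rewrite -(ler_pM2l q0) -Deps; exact: slope_bump_sqr_le.
- move=> y Uy; have [Vy|nVy] := pselect (V y); last first.
    have -> : pb F g y = h y.
      rewrite hE; apply: near_eq_poissonl => //.
      have : \forall z \near y, ~ V z.
        by apply: open_nbhs_nbhs; split=> //; rewrite openC.
      apply: filterS => z nVz; rewrite /F memNset// addr0//.
    by apply: le_trans (dP y Uy nVy) _; lra.
  have [cy yr] := Vy.
  have [] := rP _ yr; rewrite subrK (coordK cy) => Ay _ hy Xxi XX.
  rewrite (poisson_chart omega cA cy Fs g_smooth).
  have df : differentiable (f \o param c) (coord c y) by exact: smooth_differentiable.
  have dv : differentiable v (coord c y) by exact: smooth_on_differentiable vs _.
  have Fn : \forall u \near coord c y, ((f \o param c) + v) u = (F \o param c) u.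
    apply: filterS (open_nbhs_nbhs (conj A_open Ay)) => u Au.
    rewrite !fctE /F /=; case: ifPn => [_|/negP nV]; first by rewrite paramK.
    congr (_ + _); rewrite -(paramK Au); apply: v0; first exact: param_dom.
    by move=> Vu; apply: nV; exact: mem_set.
  rewrite /differential_in.
  have [_ ->] := near_eq_diff (differentiableD df dv) Fn.
  have hyE : h y = 'd (f \o param c) (coord c y) (vf c g y).
    by have := poisson_chart omega cA cy f_smooth g_smooth; rewrite -hE; exact.
  have -> : 'd (f \o param c + v) (coord c y) (vf c g y) =
      h y + 'd v (coord c y) (vf c g y).
    by rewrite hyE; exact: (congr1 (@^~ (vf c g y)) (diffD df dv)).
  apply: (ler_sub_add hy).
  exact: (diff_slope_bump_le _ S_sym S_ge0 q0 D0 _ Xxi XX).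
- by move=> y nVy; rewrite /F memNset// addr0.
Qed.

End AtPoint.

(** The parameter [D] of [lower_maximum] is eliminated by [D^3 = (l / 2) eps^2],
where [l = - {{h, g}, g}(x)]; then [P eps^2 <= 4 D^3]. If [l = 0] then [P = 0],
and there is nothing to lower. *)
Lemma lower_maximum_powR x f g h (U : set M) (P : R) :
  smooth f -> smooth g -> h = pb f g -> (forall y, h y <= h x) ->
  nondegenerate_critical h x -> nbhs x U -> compact (closure U) ->
  (forall y, closure U y -> y <> x -> h y < h x) ->
  0 <= P <= 2 * - pb (pb h g) g x ->
  exists V : set M, [/\ nbhs x V, closure V `<=` U &
    \forall eps \near 0^'+, exists F, [/\ smooth F,
      forall y, `|F y - f y| <= eps,
      forall y, U y -> pb F g y <= h x - 3^-1 * (P `^ 3^-1) * (eps `^ (2 / 3)) &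
      forall y, ~ V y -> F y = f y]].
Proof.
move=> fs gs hE h_max h_nd Ux cU h_lt /andP[P0 Pl].
set l := - pb (pb h g) g x in Pl *.
have [l0|l0] := leP l 0.
  have [V Vx VU] := compact_regular (@carrier_hausdorff _ _ M) cU
    (filterS (@subset_closure _ U) Ux) Ux.
  have P00 : P = 0 by lra.
  exists V; split=> //; near=> eps; exists f; split=> // y.
    by rewrite subrr normr0.
  move=> _; rewrite P00 powR0 ?invr_eq0 ?pnatr_eq0// mulr0 mul0r subr0.
  by rewrite -hE; exact: h_max.
have [V [Vx cV VU [D0 D00 DP]]] := lower_maximum fs gs hE h_max h_nd Ux cU h_lt l0.
exists V; split=> //; first by rewrite -(closure_id V).1.
have cube (a : R) : 0 <= a -> (a `^ 3^-1) ^+ 3 = a.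
  by move=> a0; rewrite -powR_mulrn ?powR_ge0// -powRrM mulVf// powRr1.
have cube2 (a : R) : 0 <= a -> (a `^ (2 / 3)) ^+ 3 = a ^+ 2.
  move=> a0; rewrite -powR_mulrn ?powR_ge0// -powRrM divfK//.
  by rewrite -powR_mulrn.
have m0 : 0 < Num.min 1 (D0 ^+ 3 / (l / 2)).
  by rewrite lt_min ltr01 divr_gt0 ?exprn_gt0// divr_gt0.
near=> eps.
have eps0 : 0 < eps by near: eps; exact: nbhs_right_gt.
have : eps < Num.min 1 (D0 ^+ 3 / (l / 2)) by near: eps; exact: nbhs_right_lt.
rewrite lt_min => /andP[eps1 epsD].
pose D := (l / 2) `^ 3^-1 * eps `^ (2 / 3).
have D3 : D ^+ 3 = l / 2 * eps ^+ 2.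
  by rewrite exprMn cube ?cube2// ?divr_ge0// ltW.
have Dgt0 : 0 < D by rewrite mulr_gt0// powR_gt0// divr_gt0.
have [|||F [Fs Ff FU FV]] := DP D eps.
- rewrite Dgt0 /= -(ltr_pXn2r (n := 3))// ?nnegrE ?ltW// D3.
  apply: le_lt_trans (_ : l / 2 * eps < _).
    by rewrite ler_pM2l ?divr_gt0// expr2 ger_pMl// ltW.
  by rewrite mulrC -ltr_pdivlMr ?divr_gt0.
- exact: ltW.
- by rewrite D3 -/l; field.
exists F; split=> // y Uy; apply: le_trans (FU y Uy) _.
rewrite lerD2l lerN2 -mulrA; set T := _ * eps `^ _.
have T0 : 0 <= T by rewrite mulr_ge0 ?powR_ge0.
have T3 : T ^+ 3 = P * eps ^+ 2 by rewrite exprMn cube ?cube2// ltW.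
suff : T <= 8 / 5 * D by lra.
(* after taking cubes, this follows from 4 <= (8 / 5) ^+ 3 *)
have D85 : 0 <= 8 / 5 * D by apply: mulr_ge0 (ltW Dgt0); rewrite divr_ge0.
rewrite -(ler_pXn2r (n := 3))// ?nnegrE// T3 exprMn D3.
have := ler_wpM2r (sqr_ge0 eps) Pl; have := mulr_ge0 (ltW l0) (sqr_ge0 eps); lra.
Unshelve. all: by end_near. Qed.

Lemma poisson_poissonN h f y : smooth h -> smooth f ->
  pb (pb h (fun z => - f z)) (fun z => - f z) y = pb (pb h f) f y.
Proof.
move=> hs fs; have hfs : smooth (pb h f) := smooth_poisson omega hs fs.
have -> : pb h (fun z => - f z) = (fun z => - pb h f z).
  by apply/funext => z; exact: poissonNr.
rewrite (poissonNr omega _ y fs).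
by rewrite (poissonNl omega f y hfs) opprK.
Qed.

End Perturbation.

Lemma sum_between_double (R : numDomainType) (a b : R) :
  0 <= a -> 0 <= b -> a <= b -> 0 <= a + b <= 2 * b.
Proof. by move=> a0 b0 ab; rewrite addr_ge0//= mulr_natl mulr2n lerD2r. Qed.

Lemma uniform_norm_le (R : realType) n (M : smoothManifold R n) (h : M -> R)
    (e : R) : (forall y, `|h y| <= e) -> (uniform_norm h <= e%:E)%E.
Proof. by move=> he; apply: ub_ereal_sup => _ [y _ <-]; rewrite lee_fin. Qed.

Theorem theorem1p1p6 (R : realType) (n : nat) (M : smoothManifold R n)
  (omega : symplecticForm M) (f g : M -> R) (x : M) (U : set M) :
  smooth f -> smooth g ->
  let pb := poisson omega in
  let Phi : M -> R := fun y =>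
    - pb (pb (pb f g) f) f y - pb (pb (pb f g) g) g y in
  (forall y, pb f g y <= pb f g x) ->
  nondegenerate_critical (pb f g) x ->
  nbhs x U -> compact (closure U) ->
  (forall y, closure U y -> y <> x -> pb f g y < pb f g x) ->
  exists V : set M, [/\ nbhs x V, closure V `<=` U &
    \forall eps \near 0^'+, exists F G : M -> R,
      [/\ smooth F /\ smooth G,
          (uniform_norm (fun y => F y - f y)%R <= eps%:E)%E,
          (uniform_norm (fun y => G y - g y)%R <= eps%:E)%E,
          forall y, U y ->
            pb F G y <= pb f g x - 3%:R^-1 * (Phi x `^ 3%:R^-1) * (eps `^ (2%:R / 3%:R)) &
          forall y, ~ V y -> F y = f y /\ G y = g y]].
Proof.
move=> fs gs pb Phi h_max h_nd Ux cU h_lt.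
have Nfs := smoothN fs.
(* Replacing [(f, g)] by [(g, - f)] leaves the bracket unchanged and exchanges
   the two terms of [Phi]. *)
have hE : pb f g = pb g (fun y => - f y).
  by apply/funext => y; rewrite /pb (poissonNr omega g y fs) (poissonC omega f g).
have hs : smooth (pb f g) := smooth_poisson omega fs gs.
have := poisson_poissonN omega x hs fs; rewrite -/pb => Nff.
have lg := poisson_poisson_ge0 fs gs erefl h_max h_nd.
have := poisson_poisson_ge0 gs Nfs hE h_max h_nd; rewrite -/pb Nff => lf.
have PhiE : Phi x = - pb (pb (pb f g) f) f x + - pb (pb (pb f g) g) g x by [].
have [fg|gf] := leP (- pb (pb (pb f g) f) f x) (- pb (pb (pb f g) g) g x).
  have Phi_le : 0 <= Phi x <= 2 * - pb (pb (pb f g) g) g x.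
    by rewrite PhiE; exact: sum_between_double lf lg fg.
  have [V [Vx VU VP]] := lower_maximum_powR fs gs erefl h_max h_nd Ux cU h_lt Phi_le.
  exists V; split; [exact: Vx|exact: VU|].
  have eps0 : \forall eps \near 0^'+, 0 <= eps :> R by exact: nbhs_right_ge.
  apply: filterS2 VP eps0 => eps [F [Fs Ff FU FV]] eps0.
  exists F, g; split;
    [split; [exact: Fs|exact: gs]|exact: uniform_norm_le Ff| |exact: FU|].
    by apply: uniform_norm_le => y; rewrite subrr normr0.
  by move=> y nVy; split; [exact: FV|exact: erefl].
have Phi_le :
    0 <= Phi x <= 2 * - pb (pb (pb f g) (fun y => - f y)) (fun y => - f y) x.
  by rewrite Nff PhiE addrC; exact: sum_between_double lg lf (ltW gf).
have [V [Vx VU VP]] := lower_maximum_powR gs Nfs hE h_max h_nd Ux cU h_lt Phi_le.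
exists V; split; [exact: Vx|exact: VU|].
have eps0 : \forall eps \near 0^'+, 0 <= eps :> R by exact: nbhs_right_ge.
apply: filterS2 VP eps0 => eps [G [Gs Gg GU GV]] eps0.
exists f, G; split; [split; [exact: fs|exact: Gs]| |exact: uniform_norm_le Gg| |].
- by apply: uniform_norm_le => y; rewrite subrr normr0.
- move=> y Uy; have fGE : pb f G y = pb G (fun z => - f z) y.
    by rewrite /pb (poissonNr omega G y fs) (poissonC omega f G).
  by rewrite fGE; exact: GU.
- by move=> y nVy; split; [exact: erefl|exact: GV].
Qed.
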